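(* Let $b\ge2$ and consider Radix Selection with a general Markov source. Choose $I_n$ uniformly on $\{1,\ldots,n\}$ and independently of all remaining quantities. Then, in distribution and with convergence of all moments, as $n\to\infty$, $$\frac{Y_n(I_n)}{n}\to m(S_1)\stackrel{d}{=}m(h(\xi)),$$ where $\xi$ is uniformly distributed on $[0,1]$.
   Context: Let $b\ge 2$ be an integer, $\Sigma=\{0,\ldots,b-1\}$, $\Sigma^\infty$ the set of infinite strings over $\Sigma$, and $\Sigma^*=\bigcup_{n\ge 0}\Sigma^n$ with $\Sigma^0=\{\emptyset\}$. Markov source: a homogeneous Markov chain on $\Sigma$ with initial distribution $\mu=(\mu_r)_{r\in\Sigma}$ and transition matrix $(p_{ij})_{i,j\in\Sigma}$, where always $0<\mu_i,p_{ij}<1$ for all $i,j\in\Sigma$. $S_1,S_2,\ldots$ are independent infinite strings, each generated by this chain. For $v,w\in\Sigma^\infty$, $j(v,w)=\max\{i\ge 0:(v_1,\ldots,v_i)=(w_1,\ldots,w_i)\}$ ($=\infty$ if $v=w$); $v<w$ means $v_{j(v,w)+1}<w_{j(v,w)+1}$ (lexicographic order), $v\le w$ means $v<w$ or $v=w$. $S_{(1)}<\cdots<S_{(n)}$ are the order statistics of $S_1,\ldots,S_n$ (a.s. distinct). $\Lambda_{n,k}(v)=\#\{1\le i\le n: j(v,S_i)\ge k\}$ for $k\ge0$; $Z_n(v)=\sum_{k\ge 0}\Lambda_{n,k}(v)\mathbf 1_{\{\Lambda_{n,k}(v)>1\}}$ for $v\in\Sigma^\infty$; $Y_n(\ell)=Z_n(S_{(\ell)})$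 for $1\le\ell\le n$ (the number of bucket operations Radix Selection needs to retrieve rank $\ell$). For $v=v_1\ldots v_k\in\Sigma^*$ with $k\ge1$, $\pi(v)=\mu_{v_1}p_{v_1v_2}\cdots p_{v_{k-1}v_k}$, and $\pi(\emptyset)=1$. $m(w)=\sum_{v\preceq w,\,v\in\Sigma^*}\pi(v)$ (sum over finite prefixes $v$ of $w$) and $F(w)=\mathbb P(S_1\le w)$ for $w\in\Sigma^\infty$; $h(t)=\sup\{v\in\Sigma^\infty:F(v)\le t\}$ for $t\in[0,1]$ (supremum in lexicographic order). *)

(* Defs.v *)
From HB Require Import structures.
From mathcomp Require Import all_boot all_order all_algebra.
From mathcomp Require Import all_classical all_reals all_analysis.
From mathcomp Require Import measurable_realfun.
Import Order.TTheory GRing.Theory Num.Theory.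
Import numFieldNormedType.Exports.

Set Implicit Arguments.
Unset Strict Implicit.
Unset Printing Implicit Defensive.

Local Open Scope classical_set_scope.
Local Open Scope ring_scope.

(* Letters of strings and strings of a sequence are indexed from 0: the v_1 and
   S_1 of the mathematics are [v 0] and [S 0]. Ranks are in {1, ..., n}. *)
Definition string (b : nat) := nat -> 'I_b.

Section Strings.
Variable b : nat.
Implicit Types (v w : string b) (s : nat -> string b).

Definition agree (i : nat) v w : bool := mkseq v i == mkseq w i.

(* [None] stands for infinity. *)
Definition lcp v w : option nat :=
  if v == w then None
  else Some (xget 0%N
    [set i | agree i v w /\ forall i', agree i' v w -> (i' <= i)%N]).

Definition lcp_ge v w (k : nat) : bool :=
  if lcp v w is Some j then (k <= j)%N else true.

Definition strlt v w : bool :=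
  if lcp v w is Some j then (v j < w j)%N else false.

Definition strle v w : bool := strlt v w || (v == w).

Definition is_strsup (A : set (string b)) u : Prop :=
  (forall v, A v -> strle v u) /\
  (forall u', (forall v, A v -> strle v u') -> strle u u').

(* Every set of strings has a supremum, so the default value is never used. *)
Definition strsup (hb : (1 < b)%N) (A : set (string b)) : string b :=
  xget (fun=> Ordinal (ltnW hb)) [set u | is_strsup A u].

Definition Lambda s (n k : nat) v : nat := #|[set i : 'I_n | lcp_ge v (s i) k]|.

(* Valued in \bar R: the sum is infinite when v occurs twice among the first n
   strings, which happens with probability zero in the application. *)
Definition Zcost (R : realType) s (n : nat) v : \bar R :=
  (\sum_(0 <= k <oo) ((Lambda s n k v * (1 < Lambda s n k v))%N%:R)%:E)%E.

Definition order_stat s (n l : nat) : string b :=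
  nth (s 0%N) (sort strle (mkseq s n)) l.-1.

Definition Ycost (R : realType) s (n l : nat) : \bar R :=
  Zcost R s n (order_stat s n l).

Definition cylinder (x : seq 'I_b) : set (string b) :=
  [set v | mkseq v (size x) = x].

Definition string_sigma : set (set (string b)) := <<s range cylinder >>.

End Strings.

Section MarkovWeights.
Variables (R : realType) (b : nat) (mu : 'I_b -> R) (p : 'M[R]_b).

Fixpoint path_weight (r : 'I_b) (x : seq 'I_b) : R :=
  if x is c :: x' then p r c * path_weight c x' else 1.

Definition word_weight (x : seq 'I_b) : R :=
  if x is r :: x' then mu r * path_weight r x' else 1.

Definition prefix_weight (w : string b) : \bar R :=
  \esum_(x in [set x : seq 'I_b | mkseq w (size x) = x]) (word_weight x)%:E.

Definition positive_source : Prop :=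
  [/\ \sum_r mu r = 1,
      forall i, \sum_j p i j = 1,
      forall i, 0 < mu i < 1 &
      forall i j, 0 < p i j < 1].

End MarkovWeights.

Section Randomness.
Local Open Scope ereal_scope.
Context (d : measure_display) (T : measurableType d) (R : realType).
Variable P : probability T R.

Definition random_string (b : nat) (X : T -> string b) : Prop :=
  forall A, string_sigma A -> measurable (X @^-1` A).

(* The Markov property is P(X_{k+1} = c | X_0 = v_0, ..., X_k = v_k) = p_{v_k c},
   multiplied by the probability of the conditioning event. *)
Definition markov_chain (b : nat) (mu : 'I_b -> R) (p : 'M[R]_b)
    (X : T -> string b) : Prop :=
  (forall r, P [set t | X t 0%N = r] = (mu r)%:E) /\
  (forall (k : nat) (v : string b) (c : 'I_b),
     P [set t | agree k.+1 (X t) v /\ X t k.+1 = c] =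
     P [set t | agree k.+1 (X t) v] * (p (v k) c)%:E).

Definition string_sigma_of (b : nat) (X : T -> string b) : set (set T) :=
  preimage_set_system setT X (@string_sigma b).

Definition string_seq_sigma (b : nat) (S : nat -> T -> string b) :
    set (set T) :=
  <<s \bigcup_i string_sigma_of (S i) >>.

Definition mutually_independent (F : nat -> set (set T)) : Prop :=
  forall (J : seq nat) (E : nat -> set T), uniq J ->
    (forall i, i \in J -> F i (E i)) ->
    P (\bigcap_(i in [set` J]) E i) = \prod_(i <- J) P (E i).

Definition independent2 (F G : set (set T)) : Prop :=
  forall A B, F A -> G B -> P (A `&` B) = P A * P B.

Definition string_cdf (b : nat) (X : T -> string b) (w : string b) : \bar R :=
  P [set t | strle (X t) w].

Definition quantile_string (b : nat) (hb : (1 < b)%N) (X : T -> string b)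
    (t : R) : string b :=
  strsup hb [set v | string_cdf X v <= t%:E].

(* Convergence of distribution functions at the continuity points of the limit;
   it is used together with [cvg_moments], which makes the limit a.s. finite. *)
Definition cvg_in_distribution (X : nat -> T -> \bar R) (Y : T -> \bar R) :
    Prop :=
  [/\ forall n, measurable_fun setT (X n),
      measurable_fun setT Y &
      forall x : R,
        {for x, continuous (fun y : R => P [set t | Y t <= y%:E])} ->
        P [set t | X n t <= x%:E] @[n --> \oo] --> P [set t | Y t <= x%:E]].

Definition cvg_moments (X : nat -> T -> \bar R) (Y : T -> \bar R) : Prop :=
  forall q : nat,
    P.-integrable setT (fun t => Y t ^+ q) /\
    \int[P]_t (X n t ^+ q) @[n --> \oo] --> \int[P]_t (Y t ^+ q).

End Randomness.

Definition eq_in_distribution (d d' : measure_display) (T : measurableType d)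
    (T' : measurableType d') (R : realType) (P : probability T R)
    (P' : probability T' R) (X : T -> \bar R) (X' : T' -> \bar R) : Prop :=
  [/\ measurable_fun setT X, measurable_fun setT X' &
      forall B : set (\bar R), measurable B ->
        P (X @^-1` B) = P' (X' @^-1` B)].

(* Main.v *)
Require Import Defs.
From HB Require Import structures.
From mathcomp Require Import all_boot all_order all_algebra.
From mathcomp Require Import all_classical all_reals all_analysis.
From mathcomp Require Import measurable_realfun.
From mathcomp Require Import zify ring lra.
Import Order.TTheory GRing.Theory Num.Theory.
Import numFieldNormedType.Exports.

Local Open Scope classical_set_scope.
Local Open Scope ring_scope.

Set Implicit Arguments.
Unset Strict Implicit.
Unset Printing Implicit Defensive.

(** Write [V] for the selected string, of rank [I n] among the first [n].

    Sorting permutes the strings, and [I n] is uniform and independent of them,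
    so an event about [V] has the average probability of the same event about
    the strings of index [0, ..., n.-1] ([resampling]). Consequently [V] has the
    law of a single string ([selected_law]), and [prefix_weight mu p V] has, for
    every [n], the law of the limit. It remains to compare this variable with
    the normalised cost, on the same probability space.

    Both are series indexed by the prefix length [k]. The [k]-th term of the
    normalised cost, [bucket_share n k], is up to [n^-1] the proportion of
    strings sharing the first [k] letters of [V]; the [k]-th term of the limit,
    [prefix_share n k], is the probability of these letters. Since there are
    finitely many words of length [k], the law of large numbers holds uniformly
    over them, and therefore applies to the random string [V]: the two terms are
    close in mean ([cvg_bucket_share]). All these terms lie in the unit interval
    and have expectations at most [2 * rho ^+ k] for some [rho < 1]: for the
    cost, because a bucket only counts when it holds two strings, and two
    independent strings agree on [k] letters with probability at most
    [rho ^+ k] ([integral_bucket_share]).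

    The rest is analysis of such pairs of series. If [s k] denotes the sum of
    the first [k] terms, the [q]-th power of the series telescopes into the
    increments [s k.+1 ^+ q - s k ^+ q], which are at most [q * k.+1 ^+ q.-1]
    times the [k]-th term. Their expectations are thus dominated by a summable
    sequence uniformly in [n], and dominated convergence of series makes the
    expected total difference between the increments of the two series vanish
    ([cvg_integral_series_distance]). For each [q] this gives the convergence of
    moments, and for [q = 1], with the Markov inequality, convergence in
    distribution.

    For the quantile description, the distribution function increases by the
    weight of [x] between the least and the greatest string with prefix [x], as
    no string has positive mass; the quantile map sends the interval between
    these two values into the cylinder of [x]. The quantile string of a uniform
    variable therefore charges every cylinder at least as much as the source
    does, hence equally since both masses sum to one, and cylinders determine
    the law ([quantile_law]). *)

(** * The lexicographic order on infinite strings *)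

Lemma agreeP (b : nat) (i : nat) (v w : string b) :
  reflect (forall j, (j < i)%N -> v j = w j) (agree i v w).
Proof.
apply: (iffP eqP) => [vw j ji|vw].
  by rewrite -(nth_mkseq (v 0%N) v ji) vw nth_mkseq.
apply: (@eq_from_nth _ (v 0%N)); rewrite !size_mkseq // => j ji.
by rewrite !nth_mkseq //; exact: vw.
Qed.

Lemma agree_sym (b : nat) (i : nat) (v w : string b) :
  agree i v w = agree i w v.
Proof. by rewrite /agree eq_sym. Qed.

Lemma agree_leq (b : nat) (i j : nat) (v w : string b) :
  (i <= j)%N -> agree j v w -> agree i v w.
Proof.
by move=> ij /agreeP vw; apply/agreeP => l li; apply: vw; exact: leq_trans ij.
Qed.

Lemma agree_first_difference (b : nat) (j k : nat) (v w : string b) :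
  agree j v w -> v j <> w j -> agree k v w = (k <= j)%N.
Proof.
move=> avw nvw; apply/idP/idP => [/agreeP kvw|kj]; last exact: agree_leq avw.
by rewrite leqNgt; apply/negP => /kvw.
Qed.

Lemma exists_first_difference (b : nat) (v w : string b) :
  v <> w -> exists j, agree j v w /\ v j <> w j.
Proof.
move=> vw.
have ex : exists j, v j != w j.
  apply: contrapT => nex; apply: vw; apply/funext => j.
  by apply: contrapT => /eqP vj; apply: nex; exists j.
exists (ex_minn ex); case: ex_minnP => j vj minj; split; last exact/eqP.
apply/agreeP => i ij; apply/eqP/negPn/negP => /minj.
by rewrite leqNgt ij.
Qed.

Lemma lcp_first_difference (b : nat) (j : nat) (v w : string b) :
  agree j v w -> v j <> w j -> lcp v w = Some j.
Proof.
move=> avw nvw; rewrite /lcp; case: eqP => [vw|_].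
  by exfalso; apply: nvw; rewrite vw.
congr Some; case: xgetP => [i -> /= [ai maxi]|/(_ j)[]].
  apply/eqP; rewrite eqn_leq -(agree_first_difference _ avw nvw) ai.
  exact: maxi.
by split=> // i; rewrite (agree_first_difference _ avw nvw).
Qed.

(** Reduces the comparison of [k] with a possibly infinite common prefix length
    to an equality of finite words. *)
Lemma lcp_geE (b : nat) (k : nat) (v w : string b) :
  lcp_ge v w k = agree k v w.
Proof.
have [->|vw] := pselect (v = w).
  by rewrite /lcp_ge /lcp eqxx; apply/esym/agreeP.
have [j [avw nvw]] := exists_first_difference vw.
by rewrite /lcp_ge (lcp_first_difference avw nvw) (agree_first_difference _ avw).
Qed.

Lemma strltP (b : nat) (v w : string b) :
  strlt v w <-> exists j, agree j v w /\ (v j < w j)%N.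
Proof.
split=> [|[j [avw lvw]]].
  have [->|vw] := pselect (v = w); first by rewrite /strlt /lcp eqxx.
  have [j [avw nvw]] := exists_first_difference vw.
  by rewrite /strlt (lcp_first_difference avw nvw) => lvw; exists j.
rewrite /strlt (@lcp_first_difference _ j) // => vw.
by rewrite vw ltnn in lvw.
Qed.

Lemma strleP (b : nat) (v w : string b) :
  strle v w <-> v = w \/ exists j, agree j v w /\ (v j < w j)%N.
Proof.
rewrite /strle; split=> [/orP[/strltP|/eqP]|[->|/strltP ->//]]; [by right|by left|].
by rewrite eqxx orbT.
Qed.

Lemma strle_refl (b : nat) (v : string b) : strle v v.
Proof. by apply/strleP; left. Qed.

Lemma strle_or_gt (b : nat) (v w : string b) :
  strle v w \/ exists j, agree j v w /\ (w j < v j)%N.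
Proof.
have [->|vw] := pselect (v = w); first by left; exact: strle_refl.
have [j [avw nvw]] := exists_first_difference vw.
case: (ltngtP (v j) (w j)) => [lvw|lvw|/val_inj//]; last by right; exists j.
by left; apply/strleP; right; exists j.
Qed.

Lemma strle_trans (b : nat) (u v w : string b) :
  strle u v -> strle v w -> strle u w.
Proof.
move=> /strleP[->//|[i [/agreeP ai li]]] /strleP[<-|[j [/agreeP aj lj]]].
  by apply/strleP; right; exists i; split=> //; apply/agreeP.
apply/strleP; right; case: (ltngtP i j) => ij.
- exists i; split; last by rewrite -(aj _ ij).
  by apply/agreeP => l li'; rewrite ai// aj// (ltn_trans li').
- exists j; split; last by rewrite (ai _ ij).
  by apply/agreeP => l lj'; rewrite ai ?(ltn_trans lj')// aj.
- exists i; split; last by rewrite (ltn_trans li)// ij.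
  by apply/agreeP => l li'; rewrite ai// aj// -ij.
Qed.

(** Order-convexity of cylinders both makes the quantile map measurable and
    locates its values. *)
Lemma cylinder_convex (b : nat) (x : seq 'I_b) (u v w : string b) :
  strle u v -> strle v w -> cylinder x u -> cylinder x w -> cylinder x v.
Proof.
rewrite /cylinder /=; set k := size x => /strleP[->//|[i [/agreeP ai li]]].
move=> /strleP[->//|[j [/agreeP aj lj]]] ux wx.
have uw : forall l, (l < k)%N -> u l = w l.
  by apply/agreeP; rewrite /agree ux wx.
rewrite -ux; apply/eqP; rewrite -/(agree k v u) agree_sym.
have [ki|ik] := leqP k i; first by apply: (agree_leq ki); apply/agreeP.
have [kj|jk] := leqP k j.
  by apply/agreeP => l lk; rewrite uw// aj// (leq_trans lk).
exfalso; case: (ltngtP i j) => ij.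
- by move: li; rewrite (aj _ ij) (uw _ ik) ltnn.
- by move: lj; rewrite -(ai _ ij) (uw _ jk) ltnn.
- by move: lj; rewrite -ij -(uw _ ik) ltnNge (ltnW li).
Qed.

(** ** Suprema of sets of strings *)

Section Supremum.
Variables (b : nat) (hb : (1 < b)%N) (A : set (string b)).

Definition continues (x : seq 'I_b) (c : 'I_b) : bool :=
  `[< exists2 v, A v & mkseq v (size x).+1 = rcons x c >].

(** The weight [c.+1] lets every letter that continues [x] beat all those that
    do not. *)
Definition greedy_letter (x : seq 'I_b) : 'I_b :=
  [arg max_(c > Ordinal (ltnW hb)) (continues x c * c.+1)]%N.

Fixpoint greedy_prefix (k : nat) : seq 'I_b :=
  if k is k'.+1 then rcons (greedy_prefix k') (greedy_letter (greedy_prefix k'))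
  else [::].

Definition greedy_string : string b :=
  fun k => greedy_letter (greedy_prefix k).

Lemma greedy_prefixE k : greedy_prefix k = mkseq greedy_string k.
Proof. by elim: k => //= k ih; rewrite mkseqS -ih. Qed.

Lemma greedy_letter_max x c : continues x c ->
  continues x (greedy_letter x) /\ (c <= greedy_letter x)%N.
Proof.
move=> xc; rewrite /greedy_letter; case: arg_maxnP => //= i _ /(_ c isT).
by rewrite xc mul1n; case: (continues x i) => //; rewrite mul1n.
Qed.

Lemma agree_continues v k : A v -> agree k v greedy_string ->
  continues (mkseq greedy_string k) (v k).
Proof.
move=> Av /eqP vk; apply/asboolP; exists v => //.
by rewrite size_mkseq mkseqS vk.
Qed.

Lemma greedy_string_in_closure k : A !=set0 ->
  exists2 v, A v & agree k v greedy_string.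
Proof.
move=> [v0 Av0]; elim: k => [|k [v Av vk]]; first by exists v0.
have /greedy_letter_max[/asboolP[w Aw wk] _] := agree_continues Av vk.
exists w => //; apply/eqP; move: wk; rewrite size_mkseq => ->.
by rewrite mkseqS -greedy_prefixE.
Qed.

(** A string of [A] first differs from the greedy string by a smaller letter,
    while [A] approaches the greedy string to any order. *)
Lemma greedy_string_sup : A !=set0 -> is_strsup A greedy_string.
Proof.
move=> A0; split=> [v Av|u uA].
  have [//|[j [vj lvj]]] := strle_or_gt v greedy_string.
  have /greedy_letter_max[_] := agree_continues Av vj.
  by rewrite -greedy_prefixE leqNgt lvj.
have [//|[j [/agreeP uj luj]]] := strle_or_gt greedy_string u.
have [v Av /agreeP vj] := greedy_string_in_closure j.+1 A0.
have /strleP[vu|[l [/agreeP vl lvl]]] := uA _ Av.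
  by move: luj; rewrite -vu vj ?ltnn.
exfalso; case: (ltngtP l j) => lj.
- by move: lvl; rewrite vj ?ltnS ?(ltnW lj)// uj// ltnn.
- by move: luj; rewrite -vl// vj ?ltnn.
- by move: lvl; rewrite lj vj// ltnNge (ltnW luj).
Qed.

Lemma strsupP : is_strsup A (strsup hb A).
Proof.
rewrite /strsup; case: xgetP => [u _ //|nosup].
have [A0|/nonemptyPn A0] := pselect (A !=set0).
  by have := nosup _ (greedy_string_sup A0).
have := nosup (fun=> Ordinal (ltnW hb)); case; split=> [v|u _]; first by rewrite A0.
by have [//|[j []]] := strle_or_gt (fun=> Ordinal (ltnW hb)) u.
Qed.

End Supremum.
(** * Measurability of events about random strings *)

Section RandomStrings.
Context (d : measure_display) (T : measurableType d) (b : nat).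
Implicit Types (X Y : T -> string b) (S : nat -> T -> string b).

Lemma measurable_finite_union (F : finType) (A : F -> set T) (Q : set F) :
  (forall x, measurable (A x)) -> measurable [set t | exists2 x, Q x & A x t].
Proof. by move=> mA; exact: fin_bigcup_measurable. Qed.

Lemma random_string_cst (w : string b) : random_string (fun _ : T => w).
Proof. by move=> A _; rewrite preimage_cst; case: ifP. Qed.

Lemma measurable_prefix X k (Q : set (seq 'I_b)) : random_string X ->
  measurable [set t | Q (mkseq (X t) k)].
Proof.
move=> mX; rewrite [X in measurable X](_ : _ = [set t |
    exists2 x : k.-tuple 'I_b, Q x & (X @^-1` cylinder x) t]).
  apply: measurable_finite_union => x; apply: mX.
  by apply: sub_sigma_algebra; exists (x : seq 'I_b).
apply/seteqP; split=> t /=; last first.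
  by move=> [x Qx]; rewrite /cylinder /= size_tuple => ->.
by move=> Qt; exists [tuple of mkseq (X t) k]; rewrite // /cylinder /= size_mkseq.
Qed.

Lemma measurable_letter X j (Q : set 'I_b) : random_string X ->
  measurable [set t | Q (X t j)].
Proof.
move=> /measurable_prefix-/(_ j.+1 [set x | exists2 c, Q c & exists s, x = rcons s c]).
congr (measurable _); apply/seteqP; split=> t /=; rewrite mkseqS.
  by move=> [c Qc [s /rcons_inj[_ ->]]].
by move=> Qt; exists (X t j) => //; eexists.
Qed.

Lemma measurable_letters X Y j (Q : 'I_b -> 'I_b -> Prop) :
  random_string X -> random_string Y -> measurable [set t | Q (X t j) (Y t j)].
Proof.
move=> mX mY; rewrite [X in measurable X](_ : _ = [set t |
    exists2 c : 'I_b, True & ([set t | X t j = c] `&` [set t | Q c (Y t j)]) t]).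
  apply: (@measurable_finite_union _ _ setT) => c.
  apply: measurableI; first exact: (measurable_letter j [set c]).
  exact: (measurable_letter j (Q c)).
by apply/seteqP; split=> t /= => [Qt|[c _ [->]]//]; exists (X t j).
Qed.

Lemma measurable_agree X Y k : random_string X -> random_string Y ->
  measurable [set t | agree k (X t) (Y t)].
Proof.
move=> mX mY; rewrite [X in measurable X](_ : _ =
    \bigcap_(j in [set j | (j < k)%N]) [set t | X t j = Y t j]).
  by apply: bigcap_measurableType => j _; exact: (measurable_letters j (@eq _)).
apply/seteqP; split=> t /= => [/agreeP//|H]; apply/agreeP => j; exact: H.
Qed.

Lemma measurable_string_eq X Y : random_string X -> random_string Y ->
  measurable [set t | X t = Y t].
Proof.
move=> mX mY; rewrite [X in measurable X](_ : _ =
    \bigcap_j [set t | X t j = Y t j]).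
  by apply: bigcap_measurableType => j _; exact: (measurable_letters j (@eq _)).
apply/seteqP; split=> t /= => [XY j _ /=|H]; first by rewrite XY.
by apply/funext => j; exact: H.
Qed.

Lemma measurable_strle X Y : random_string X -> random_string Y ->
  measurable [set t | strle (X t) (Y t)].
Proof.
move=> mX mY; rewrite [X in measurable X](_ : _ = [set t | X t = Y t] `|`
    \bigcup_j ([set t | agree j (X t) (Y t)] `&` [set t | X t j < Y t j]%N)).
  apply: measurableU; first exact: measurable_string_eq.
  apply: bigcup_measurable => j _; apply: measurableI; first exact: measurable_agree.
  exact: (measurable_letters j (fun c e => c < e)%N).
apply/seteqP; split=> t /=.
  by move=> /strleP[|[j [? ?]]]; [left|right; exists j].
by move=> [?|[j _ [? ?]]]; apply/strleP; [left|right; exists j].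
Qed.

(** Finitely many measurable tests determine both the sorting permutation and
    the sizes of the buckets. *)
Lemma measurable_finite_test (F : finType) (B : F -> T -> bool) (Q : set {set F}) :
  (forall i, measurable [set t | B i t]) ->
  measurable [set t | Q [set i | B i t]%SET].
Proof.
move=> mB; rewrite [X in measurable X](_ : _ = [set t |
    exists2 A, Q A & (\bigcap_i [set t | B i t = (i \in A)]) t]).
  apply: measurable_finite_union => A; apply: fin_bigcap_measurable => // i _.
  case: (i \in A); first exact: mB.
  rewrite [X in measurable X](_ : _ = ~` [set t | B i t]).
    exact/measurableC/mB.
  by apply/seteqP; split=> t /= => [->|/negP/negbTE].
apply/seteqP; split=> t /=; first by exists [set i | B i t]%SET => // i _ /=; rewrite inE.
by move=> [A QA At]; suff -> : [set i | B i t]%SET = A by []; apply/setP => i; rewrite inE At.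
Qed.

End RandomStrings.
(** * Order statistics and resampling *)

(** Sorting indices instead of strings turns an order statistic into the string
    at a random index. *)
Definition rank_index (b : nat) (s : nat -> string b) (n l : nat) : nat :=
  nth 0%N (sort (relpre s (@strle b)) (iota 0 n)) l.-1.

Lemma order_statE (b : nat) (s : nat -> string b) n l :
  order_stat s n l = s (rank_index s n l).
Proof.
rewrite /order_stat /rank_index /mkseq sort_map.
have [lt|ge] := ltnP l.-1 (size (sort (relpre s (@strle b)) (iota 0 n))).
  by rewrite (nth_map 0%N).
by rewrite !nth_default ?size_map.
Qed.

Lemma big_rank_index (V : Type) (idx : V) (op : Monoid.com_law idx)
    (b : nat) (s : nat -> string b) n (f : nat -> V) :
  \big[op/idx]_(l < n) f (rank_index s n l.+1) = \big[op/idx]_(i < n) f i.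
Proof.
rewrite -[RHS](big_mkord xpredT f) /index_iota subn0.
rewrite -(perm_big _ (permEl (perm_sort (relpre s (@strle b)) (iota 0 n)))) /=.
by rewrite (big_nth 0%N) size_sort size_iota big_mkord.
Qed.

Section RankMeasurable.
Context (d : measure_display) (T : measurableType d) (b : nat).
Variables (S : nat -> T -> string b).
Hypothesis mS : forall i, random_string (S i).

(** The sorting permutation depends on the strings through finitely many
    comparisons, so its values are measurable. *)
Lemma measurable_rank_index n l (Q : set nat) :
  measurable [set t | Q (rank_index (S ^~ t) n l)].
Proof.
pose B (ij : 'I_n * 'I_n) t := strle (S ij.1 t) (S ij.2 t).
pose r (C : {set 'I_n * 'I_n}) (i j : nat) :=
  [exists ij in C, (ij.1 == i :> nat) && (ij.2 == j :> nat)].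
have -> : [set t | Q (rank_index (S ^~ t) n l)] = [set t |
    [set C | Q (nth 0%N (sort (r C) (iota 0 n)) l.-1)] [set ij | B ij t]%SET].
  apply/seteqP; suff H t : rank_index (S ^~ t) n l =
      nth 0%N (sort (r [set ij | B ij t]%SET) (iota 0 n)) l.-1.
    by split=> t /=; rewrite H.
  rewrite /rank_index -val_enum_ord [in LHS]sort_map [in RHS]sort_map; congr nth; congr (map _ (sort _ _)).
  apply/funext => i; apply/funext => j /=; apply/idP/existsP => [Sij|[[i' j'] /= /andP[]]].
    by exists (i, j); rewrite inE /B /= !eqxx Sij.
  by rewrite inE /B /= => + /andP[/eqP <- /eqP <-].
by apply: measurable_finite_test => ij; exact: measurable_strle.
Qed.

Lemma measurable_rank_event n l (E : nat -> set T) :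
  (forall i, measurable (E i)) ->
  measurable [set t | E (rank_index (S ^~ t) n l) t].
Proof.
move=> mE; rewrite [X in measurable X](_ : _ =
    \bigcup_i ([set t | rank_index (S ^~ t) n l = i] `&` E i)).
  apply: bigcup_measurable => i _; apply: measurableI => //.
  exact: (measurable_rank_index n l [set i]).
by apply/seteqP; split=> t /= => [Et|[i _ [<-]]//]; exists (rank_index (S ^~ t) n l).
Qed.

Lemma measurable_random_rank_event n (I : T -> nat) (E : nat -> set T) :
  measurable_fun setT I -> (forall i, measurable (E i)) ->
  measurable [set t | E (rank_index (S ^~ t) n (I t)) t].
Proof.
move=> mI mE; rewrite [X in measurable X](_ : _ =
  \bigcup_l ([set t | E (rank_index (S ^~ t) n l) t] `&` I @^-1` [set l])).
  apply: bigcup_measurable => l _; apply: measurableI.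
    exact: measurable_rank_event.
  by rewrite -[X in measurable X]setTI; exact: mI.
by apply/seteqP; split=> t /= => [Et|[l _ [+ ->]]//]; exists (I t).
Qed.

End RankMeasurable.

Section Resampling.
Context (d : measure_display) (T : measurableType d) (R : realType).
Variables (P : probability T R) (b : nat) (S : nat -> T -> string b).
Hypothesis mS : forall i, random_string (S i).
Variables (n : nat) (I : T -> nat).
Hypothesis n0 : (0 < n)%N.
Hypothesis mI : measurable_fun setT I.
Hypothesis I_uniform :
  forall l, (1 <= l <= n)%N -> P (I @^-1` [set l]) = (n%:R^-1)%:E.
Hypothesis I_indep :
  independent2 P (preimage_set_system setT I measurable) (string_seq_sigma S).

Local Open Scope ereal_scope.

Lemma measurable_string_seq_sigma (A : set T) :
  string_seq_sigma S A -> measurable A.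
Proof.
apply: smallest_sub; first exact: sigma_algebra_measurable.
by move=> B [i _ [C mC <-]]; rewrite setTI; exact: mS.
Qed.

Lemma random_string_generated (i : nat) :
  random_string (S i : g_sigma_algebraType
    (\bigcup_i string_sigma_of (S i)) -> string b).
Proof.
move=> A mA; apply: sub_sigma_algebra; exists i => //; exists A => //.
by rewrite setTI.
Qed.

Lemma sum_indic (m : nat) (E : nat -> set T) : (forall i, measurable (E i)) ->
  \sum_(i < m) P (E i) = \int[P]_t (\sum_(i < m) (\1_(E i) t)%:E).
Proof.
move=> mE; rewrite ge0_integral_sum //=; last first.
  by move=> i; exact/measurable_EFinP/measurable_indic.
by apply: eq_bigr => i _; rewrite integral_indic// setIT.
Qed.

Lemma measurable_index_eq l : measurable (I @^-1` [set l]).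
Proof. by rewrite -[X in measurable X]setTI; exact: mI. Qed.

(* The [n] masses [n^-1] exhaust the probability: [I] leaves this range on a
   null set only. *)
Let bad := \bigcap_(l in [set l | (1 <= l <= n)%N]) ~` (I @^-1` [set l]).

Let mbad : measurable bad.
Proof.
by apply: bigcap_measurableType => l _; exact/measurableC/measurable_index_eq.
Qed.

Let indic_split (E : set T) t :
  (\1_E t)%:E = \sum_(l < n) (\1_(E `&` (I @^-1` [set l.+1])) t)%:E
               + (\1_(E `&` bad) t)%:E :> \bar R.
Proof.
have [It|It] := pselect (1 <= I t <= n)%N.
  have ltIn : ((I t).-1 < n)%N by lia.
  rewrite (bigD1 (Ordinal ltIn)) //= big1 ?adde0 => [|l /eqP lI].
    rewrite !indicE !in_setI (_ : (t \in bad) = false) ?andbF ?adde0.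
      rewrite (_ : (t \in I @^-1` _) = true) ?andbT //.
      by apply/mem_set => /=; lia.
    by apply/negbTE/negP => /set_mem/(_ (I t) It); exact.
  rewrite indicE in_setI (_ : (t \in I @^-1` _) = false) ?andbF //.
  apply/negbTE/negP => /set_mem /= Il; apply: lI; apply: val_inj => /=; lia.
rewrite big1 ?add0e => [|l _].
  rewrite !indicE in_setI (_ : (t \in bad) = true) ?andbT //.
  by apply/mem_set => l /= ln Il; apply: It; rewrite Il.
rewrite indicE in_setI (_ : (t \in I @^-1` _) = false) ?andbF //.
by apply/negbTE/negP => /set_mem /= Il; apply: It; rewrite Il /=.
Qed.

Let partition_index (E : set T) : measurable E ->
  P E = \sum_(l < n) P (E `&` (I @^-1` [set l.+1])) + P (E `&` bad).
Proof.
move=> mE.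
have mEI l : measurable (E `&` (I @^-1` [set l.+1])).
  exact/measurableI/measurable_index_eq.
have mEb : measurable (E `&` bad) by exact: measurableI.
rewrite (sum_indic n mEI) -[in LHS](setIT E) -integral_indic //.
rewrite -[X in _ + P X](setIT (E `&` bad)) -integral_indic //.
rewrite -ge0_integralD //=.
- by apply: eq_integral => t _; exact: indic_split.
- by move=> t _; apply: sume_ge0 => l _; rewrite lee_fin.
- by apply: emeasurable_sum => l; exact/measurable_EFinP/measurable_indic.
- exact/measurable_EFinP/measurable_indic.
Qed.

Let bad0 : P bad = 0.
Proof.
have := partition_index measurableT; rewrite probability_setT setTI.
rewrite (eq_bigr (fun=> (n%:R^-1)%:E)) => [|l _]; last first.
  by rewrite setTI I_uniform //= ltn_ord.
rewrite sumEFin sumr_const card_ord -(mulr_natl (n%:R^-1 : R)) mulfV ?pnatr_eq0 -?lt0n //.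
have : P bad \is a fin_num by exact: fin_num_measure.
by case: (P bad) => // r _; rewrite -EFinD => -[r0]; congr EFin; lra.
Qed.

(** Independence factors the probability of each event [I = l]. *)
Lemma uniform_index_event (E : nat -> set T) :
  (forall l, string_seq_sigma S (E l)) ->
  measurable [set t | E (I t) t] ->
  P [set t | E (I t) t] = (n%:R^-1)%:E * \sum_(l < n) P (E l.+1).
Proof.
move=> mE mEI; rewrite (partition_index mEI).
rewrite (_ : P (_ `&` bad) = 0) ?adde0; last first.
  apply/eqP; rewrite eq_le measure_ge0 andbT -bad0; apply: le_measure => //.
  - by rewrite inE; exact: measurableI.
  - by rewrite inE.
rewrite ge0_sume_distrr => [|l _]; last exact: measure_ge0.
apply: eq_bigr => l _; rewrite -(I_uniform (l := l.+1)) ?ltn_ord //.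
rewrite -I_indep //; last by exists [set l.+1] => //; rewrite setTI.
congr (P _); apply/seteqP; split=> t /= [].
  by move=> + Il; rewrite Il.
by move=> -> Et.
Qed.

(** Selecting a uniform rank amounts to selecting a uniform index: sorting only
    permutes the strings. *)
Lemma resampling (E : nat -> set T) :
  (forall i, string_seq_sigma S (E i)) ->
  P [set t | E (rank_index (S ^~ t) n (I t)) t] =
  (n%:R^-1)%:E * \sum_(i < n) P (E i).
Proof.
move=> mE; have mE' i : measurable (E i) by exact: measurable_string_seq_sigma.
pose E' l := [set t | E (rank_index (S ^~ t) n l) t].
have mE'' l : measurable (E' l) by exact: measurable_rank_event.
rewrite -[LHS]/(P [set t | E' (I t) t]) uniform_index_event; last 2 first.
- move=> l; apply: (@measurable_rank_event _ (g_sigma_algebraType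
    (\bigcup_i string_sigma_of (S i)))) => //; exact: random_string_generated.
- exact: measurable_random_rank_event.
congr (_ * _); rewrite (sum_indic n (fun l => mE'' l.+1)) (sum_indic n mE').
apply: eq_integral => t _.
rewrite -(big_rank_index _ (S ^~ t) n (fun i => (\1_(E i) t)%:E)).
by apply: eq_bigr => l _; rewrite !indicE.
Qed.

End Resampling.
(** * The law of a random string *)

(** A measurable type is pointed, which here takes a letter, provided by [hb]. *)
Definition pointed_string (b : nat) (hb : (1 < b)%N) := string b.
HB.instance Definition _ b hb := Choice.on (@pointed_string b hb).
HB.instance Definition _ b hb :=
  isPointed.Build (@pointed_string b hb) (fun=> Ordinal (ltnW hb)).

Definition cylinder_space (b : nat) (hb : (1 < b)%N) :=
  g_sigma_algebraType (range (@cylinder b) : set (set (pointed_string hb))).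
HB.instance Definition _ b hb := Measurable.on (@cylinder_space b hb).

Lemma random_string_id (b : nat) (hb : (1 < b)%N) :
  random_string (id : cylinder_space hb -> string b).
Proof. by []. Qed.

Lemma measurable_random_string (b : nat) (hb : (1 < b)%N) (d : measure_display)
    (T : measurableType d) (X : T -> string b) :
  random_string X -> measurable_fun setT (X : T -> cylinder_space hb).
Proof. by move=> mX _ A mA; rewrite setTI; exact: mX. Qed.

Lemma take_mkseq (A : Type) (f : nat -> A) (k n : nat) : (k <= n)%N ->
  mkseq f k = take k (mkseq f n).
Proof. by move=> kn; rewrite /mkseq -map_take take_iota (minn_idPl kn). Qed.

Lemma cylinderI (b : nat) (x y : seq 'I_b) :
  cylinder x `&` cylinder y = set0 \/
  exists z, cylinder x `&` cylinder y = cylinder z.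
Proof.
wlog xy : x y / (size x <= size y)%N => [hw|].
  by case: (leqP (size x) (size y)) => [/hw //|/ltnW/hw]; rewrite setIC.
have [yx|yx] := pselect (take (size x) y = x).
  right; exists y; apply/seteqP; split=> v /=; [by case|rewrite /cylinder /= => vy].
  by split=> //; rewrite -[RHS]yx -[in RHS]vy -take_mkseq.
left; apply/seteqP; split=> v //= [vx vy]; apply: yx.
by rewrite -vy -[RHS]vx -take_mkseq.
Qed.

Section LawUnique.
Context (R : realType) (d d' : measure_display).
Context (T : measurableType d) (T' : measurableType d').
Variables (P : probability T R) (P' : probability T' R).

(** Cylinders generate the sigma-algebra and, together with the empty set, are
    stable under intersection: they determine the law of a random string. *)
Lemma law_unique (b : nat) (hb : (1 < b)%N) (X : T -> string b)
    (X' : T' -> string b) :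
  random_string X -> random_string X' ->
  (forall x, P (X @^-1` cylinder x) = P' (X' @^-1` cylinder x)) ->
  forall A, string_sigma A -> P (X @^-1` A) = P' (X' @^-1` A).
Proof.
move=> mX mX' XX' A mA.
have mXM : measurable_fun setT (X : T -> cylinder_space hb).
  exact: measurable_random_string.
have mXM' : measurable_fun setT (X' : T' -> cylinder_space hb).
  exact: measurable_random_string.
pose XM : {mfun T >-> cylinder_space hb} :=
  HB.pack (X : T -> cylinder_space hb)
    (isMeasurableFun.Build _ _ _ _ _ mXM).
pose XM' : {mfun T' >-> cylinder_space hb} :=
  HB.pack (X' : T' -> cylinder_space hb)
    (isMeasurableFun.Build _ _ _ _ _ mXM').
pose G : set (set (cylinder_space hb)) := range (@cylinder b) `|` [set set0].
have GE : <<s G >> A.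
  move: A mA; by apply: sub_sigma_algebra2; left.
apply: (@g_sigma_algebra_measure_unique _ R (cylinder_space hb) G _
  (fun=> cylinder [::]) _ _ (distribution P XM) (distribution P' XM')) => //.
- by move=> B [?|->]; [exact: sub_sigma_algebra|exact: measurable0].
- by move=> _; left; exists [::].
- by apply/seteqP; split=> v //= _; exists 0%N.
- move=> B C [[x _ <-]|->]; last by rewrite set0I; right.
  move=> [[y _ <-]|->]; last by rewrite setI0; right.
  have [e|[z e]] := cylinderI x y; first by right.
  by left; exists z.
- move=> B [[x _ <-]|->]; first exact: XX'.
  rewrite -[LHS]/(P (X @^-1` set0)) -[RHS]/(P' (X' @^-1` set0)).
  by rewrite !preimage_set0 !measure0.
- move=> _; rewrite -[X in (X < _)%E]/(P (X @^-1` cylinder [::])).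
  apply: (@le_lt_trans _ _ 1%E); last exact: ltry.
  by apply: probability_le1; apply: mX; apply: sub_sigma_algebra; exists [::].
Qed.

Lemma eq_distribution_integral (Y : T -> \bar R) (Y' : T' -> \bar R)
    (f : \bar R -> \bar R) :
  eq_in_distribution P P' Y Y' -> measurable_fun setT f ->
  (forall y, 0 <= f y)%E ->
  (\int[P]_t f (Y t) = \int[P']_t f (Y' t))%E.
Proof.
move=> [mY mY' YY'] mf f0.
have := @ge0_integral_pushforward _ _ _ _ _ _ mY P setT f measurableT mf.
rewrite preimage_setT => <- //.
have := @ge0_integral_pushforward _ _ _ _ _ _ mY' P' setT f measurableT mf.
rewrite preimage_setT => <- //.
pose YM : {mfun T >-> \bar R} :=
  HB.pack Y (isMeasurableFun.Build _ _ _ _ _ mY).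
pose YM' : {mfun T' >-> \bar R} :=
  HB.pack Y' (isMeasurableFun.Build _ _ _ _ _ mY').
have := @eq_measure_integral _ _ _ setT (distribution P' YM') (distribution P YM) f.
by apply=> A mA _; exact: YY'.
Qed.

End LawUnique.
(** * Markov weights *)

Section Weights.
Context (R : realType) (b : nat) (mu : 'I_b -> R) (p : 'M[R]_b).

Lemma path_weight_rcons r x c :
  path_weight p r (rcons x c) = path_weight p r x * p (last r x) c.
Proof. by elim: x r => [|a x ih] r /=; rewrite ?mulr1 ?mul1r// ih mulrA. Qed.

Lemma word_weight_mkseqS v k :
  word_weight mu p (mkseq v k.+2) = word_weight mu p (mkseq v k.+1) * p (v k) (v k.+1).
Proof.
rewrite (mkseqS _ k.+1) /= path_weight_rcons mulrA; congr (_ * p _ _).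
by rewrite -[LHS]/(last (v 0%N) (mkseq v k.+1)) mkseqS last_rcons.
Qed.

Hypothesis hsource : positive_source mu p.

Lemma word_weight_ge0 x : 0 <= word_weight mu p x.
Proof.
have [_ _ mu01 p01] := hsource.
have pw r y : 0 <= path_weight p r y.
  elim: y r => //= c y ih r; apply: mulr_ge0 => //.
  by have /andP[/ltW] := p01 r c.
case: x => //= r x; apply: mulr_ge0 => //.
by have /andP[/ltW] := mu01 r.
Qed.

Lemma word_weight_geometric :
  exists2 rho : R, 0 <= rho < 1 & forall x, word_weight mu p x <= rho ^+ size x.
Proof.
have [_ _ mu01 p01] := hsource.
pose q (ij : 'I_b * 'I_b) := p ij.1 ij.2.
pose rho : R := Order.max (\big[Order.max/0]_r mu r) (\big[Order.max/0]_ij q ij).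
have rho0 : 0 <= rho by rewrite le_max bigmax_ge_id.
have mur r : mu r <= rho by rewrite le_max le_bigmax.
have pr i j : p i j <= rho by rewrite le_max (le_bigmax 0 q (i, j)) orbT.
exists rho => [|x].
  rewrite rho0 gt_max !bigmax_lt // => [ij|r] _; first by have /andP[] := p01 ij.1 ij.2.
  by have /andP[] := mu01 r.
have pw r y : 0 <= path_weight p r y <= rho ^+ size y.
  elim: y r => [r|c y ih r] /=; first by rewrite lexx ler01.
  have /andP[ih0 ihr] := ih c; have /andP[/ltW p0 _] := p01 r c.
  by rewrite mulr_ge0 // exprS ler_pM.
case: x => //= r x; have /andP[pw0 pwr] := pw r x.
by rewrite exprS ler_pM //; have /andP[/ltW] := mu01 r.
Qed.

Lemma prefix_weightE w :
  prefix_weight mu p w = (\sum_(k <oo) (word_weight mu p (mkseq w k))%:E)%E.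
Proof.
rewrite /prefix_weight nneseries_esumT => [|k]; last first.
  by rewrite lee_fin word_weight_ge0.
apply: (@reindex_esum R nat (seq 'I_b) setT _ (mkseq w)); split.
- by move=> k _ /=; rewrite size_mkseq.
- by move=> k l _ _ /(congr1 size); rewrite !size_mkseq.
- by move=> x /= wx; exists (size x).
Qed.

Lemma measurable_prefix_weight (d : measure_display) (T : measurableType d)
    (X : T -> string b) : random_string X ->
  measurable_fun setT (fun t => prefix_weight mu p (X t)).
Proof.
move=> mX; under eq_fun do rewrite prefix_weightE.
apply: (@ge0_emeasurable_sum _ _ _ _
  (fun k t => (word_weight mu p (mkseq (X t) k))%:E) xpredT) => [k t _ _|k _].
  by rewrite lee_fin word_weight_ge0.
apply/measurable_EFinP => _ B mB; rewrite setTI.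
exact: (measurable_prefix k [set x | B (word_weight mu p x)]).
Qed.

End Weights.
(** * Prefixes of Markov strings *)

Section PrefixLaw.
Local Open Scope ereal_scope.
Context (d : measure_display) (T : measurableType d) (R : realType).
Variables (P : probability T R) (b : nat).

Lemma measurable_cylinder (X : T -> string b) (x : seq 'I_b) :
  random_string X -> measurable (X @^-1` cylinder x).
Proof. by apply; apply: sub_sigma_algebra; exists x. Qed.

Lemma measure_prefix_partition (X : T -> string b) (E : set T) k :
  random_string X -> measurable E ->
  P E = \sum_(x : k.-tuple 'I_b) P (E `&` X @^-1` cylinder x).
Proof.
move=> mX mE.
have mEx (x : k.-tuple 'I_b) : measurable (E `&` X @^-1` cylinder x).
  by apply: measurableI => //; exact: measurable_cylinder.
transitivity (\int[P]_t
    \sum_(x : k.-tuple 'I_b) (\1_(E `&` X @^-1` cylinder x) t)%:E); last first.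
  rewrite ge0_integral_sum //=; last first.
    by move=> x; exact/measurable_EFinP/measurable_indic.
  by apply: eq_bigr => x _; rewrite integral_indic // setIT.
rewrite -[in LHS](setIT E) -integral_indic //; apply: eq_integral => t _.
rewrite (bigD1 [tuple of mkseq (X t) k]) //= big1 ?adde0 => [|x /eqP xk].
  rewrite !indicE in_setI (_ : (t \in X @^-1` _) = true) ?andbT //.
  by apply/mem_set; rewrite /cylinder /= size_mkseq.
rewrite indicE in_setI (_ : (t \in X @^-1` _) = false) ?andbF //.
apply/negbTE/negP => /set_mem; rewrite /cylinder /= size_tuple => Xx.
by apply: xk; apply: val_inj.
Qed.

Variables (mu : 'I_b -> R) (p : 'M[R]_b).
Hypothesis hsource : positive_source mu p.

Lemma prob_agree_string (X : T -> string b) (v : string b) k :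
  markov_chain P mu p X ->
  P [set t | agree k (X t) v] = (word_weight mu p (mkseq v k))%:E.
Proof.
move=> [init trans]; elim: k => [|[|k] ih].
- rewrite (_ : [set t | _] = setT) ?probability_setT //.
  by apply/seteqP; split=> // t _ /=; exact/agreeP.
- rewrite /= mulr1 -init; congr (P _); apply/seteqP; split=> t /=.
    by move=> /agreeP; exact.
  by move=> Xv; apply/agreeP => -[].
- rewrite word_weight_mkseqS EFinM -ih -trans; congr (P _).
  apply/seteqP; split=> t /= [].
    move=> Xv; split; first exact: agree_leq Xv.
    by move/agreeP : Xv; exact.
  move=> /agreeP Xv Xk; apply/agreeP => j.
  by rewrite ltnS leq_eqVlt => /predU1P[->//|/Xv].
Qed.

Lemma prob_cylinder (hb : (1 < b)%N) (X : T -> string b) (x : seq 'I_b) :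
  markov_chain P mu p X ->
  P (X @^-1` cylinder x) = (word_weight mu p x)%:E.
Proof.
move=> mX; pose v := nth (Ordinal (ltnW hb)) x : string b.
have xE : x = mkseq v (size x) by rewrite mkseq_nth.
rewrite [in RHS]xE -(prob_agree_string _ _ mX); congr (P _).
by apply/seteqP; split=> t; rewrite /cylinder /agree /= -xE => /eqP.
Qed.

Lemma sum_word_weight (hb : (1 < b)%N) (X : T -> string b) k :
  random_string X -> markov_chain P mu p X ->
  \sum_(x : k.-tuple 'I_b) (word_weight mu p x)%:E = 1.
Proof.
move=> mX markX; rewrite -(probability_setT P).
rewrite (measure_prefix_partition k mX measurableT).
by apply: eq_bigr => x _; rewrite setTI prob_cylinder.
Qed.

Lemma independent_pair (S : nat -> T -> string b) i j (A B : set T) :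
  mutually_independent P (fun i => string_sigma_of (S i)) -> i != j ->
  string_sigma_of (S i) A -> string_sigma_of (S j) B ->
  P (A `&` B) = P A * P B.
Proof.
move=> ind ij SA SB.
have /= := ind [:: i; j] (fun l => if l == i then A else B).
rewrite !big_cons big_nil mule1 eqxx (eq_sym j) (negbTE ij) inE ij => <- //.
- congr (P _); apply/seteqP; split=> t /=.
    by move=> [At Bt] l /=; rewrite !inE => /orP[]/eqP ->;
      rewrite ?eqxx // eq_sym (negbTE ij).
  move=> H; have := H i; have := H j.
  by rewrite /= !inE !eqxx orbT (eq_sym j) (negbTE ij) => /(_ isT) ? /(_ isT).
- move=> l; rewrite !inE => /orP[]/eqP ->; first by rewrite eqxx.
  by rewrite eq_sym (negbTE ij).
Qed.

Lemma string_sigma_of_cylinder (X : T -> string b) (x : seq 'I_b) :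
  string_sigma_of X (X @^-1` cylinder x).
Proof.
exists (cylinder x); last by rewrite setTI.
by apply: sub_sigma_algebra; exists x.
Qed.

(** Given that the first string has prefix [x], the second one agrees with
    probability the weight of [x], at most [rho ^+ k]. *)
Lemma prob_agree_independent (hb : (1 < b)%N) (S : nat -> T -> string b) i j k rho :
  (forall i, random_string (S i)) -> (forall i, markov_chain P mu p (S i)) ->
  mutually_independent P (fun i => string_sigma_of (S i)) -> i != j ->
  (forall x, word_weight mu p x <= rho ^+ size x)%R ->
  P [set t | agree k (S i t) (S j t)] <= (rho ^+ k)%:E.
Proof.
move=> mS markS ind ij rhoP.
rewrite (measure_prefix_partition k (mS i)); last exact: measurable_agree.
rewrite -[leRHS]mule1 -(sum_word_weight hb k (mS i) (markS i)).
rewrite ge0_sume_distrr => [|x _]; last by rewrite lee_fin word_weight_ge0.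
apply: lee_sum => x _.
rewrite (_ : _ `&` _ = S j @^-1` cylinder x `&` S i @^-1` cylinder x).
  rewrite (independent_pair ind (i := j) (j := i)) 1?eq_sym //; try exact: string_sigma_of_cylinder.
  rewrite !(prob_cylinder hb) //.
  rewrite -!EFinM lee_fin ler_wpM2r ?word_weight_ge0 //.
  by have := rhoP x; rewrite size_tuple.
apply/seteqP; split=> t; rewrite /cylinder /agree /= size_tuple.
  by move=> [/eqP -> ->].
by move=> [-> ->].
Qed.

End PrefixLaw.
(** * Powers of series with terms in the unit interval *)

Section PowerIncrements.
Context (R : realType).
Implicit Types a c : nat -> R.

Lemma expr_lipschitz (x y K : R) q : 0 <= x <= K -> 0 <= y <= K ->
  `|x ^+ q.+1 - y ^+ q.+1| <= q.+1%:R * K ^+ q * `|x - y|.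
Proof.
move=> /andP[x0 xK] /andP[y0 yK]; rewrite subrXX normrM mulrC.
rewrite ler_wpM2r // (le_trans (ler_norm_sum _ _ _)) //.
rewrite mulr_natl -[X in _ <= _ *+ X]card_ord -sumr_const ler_sum // => i _.
have iq : (i <= q)%N by rewrite -ltnS.
rewrite ger0_norm ?mulr_ge0 ?exprn_ge0 //= -[X in K ^+ X](subnK iq).
by rewrite exprD ler_pM ?exprn_ge0 // lerXn2r // nnegrE (le_trans _ xK).
Qed.

(** Telescoping turns a power of a series into a series, hence a moment into a
    series of expectations. *)
Definition power_increment a q k : R :=
  (\sum_(j < k.+1) a j) ^+ q - (\sum_(j < k) a j) ^+ q.

Lemma partial_sum_bound a k : (forall j, 0 <= a j <= 1) ->
  0 <= \sum_(j < k) a j <= k%:R.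
Proof.
move=> a01; rewrite sumr_ge0 => [|j _]; last by have /andP[] := a01 j.
rewrite -[k in k%:R]card_ord -[X in _ <= X]sumr_const ler_sum // => j _.
by have /andP[] := a01 j.
Qed.

(** The partial sums involved are at most [k.+1], where the [q.+1]-th power is
    Lipschitz with constant [q.+1 * k.+1 ^+ q]. *)
Lemma power_increment_bound a q k : (forall j, 0 <= a j <= 1) ->
  0 <= power_increment a q.+1 k <= q.+1%:R * k.+1%:R ^+ q * a k.
Proof.
move=> a01; have /andP[ak0 _] := a01 k.
have /andP[s0 sk] := partial_sum_bound k a01.
have /andP[s0' sk'] := partial_sum_bound k.+1 a01.
have ss : \sum_(j < k) a j <= \sum_(j < k.+1) a j by rewrite big_ord_recr lerDl.
have i0 : 0 <= power_increment a q.+1 k.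
  by rewrite subr_ge0 lerXn2r // nnegrE.
rewrite i0 /= -[leLHS]ger0_norm //.
apply: (le_trans (expr_lipschitz (K := k.+1%:R) q _ _)).
- by rewrite s0'.
- by rewrite s0 (le_trans ss).
- by rewrite big_ord_recr /= [X in `|X|]addrAC subrr add0r ger0_norm.
Qed.

Lemma power_increment_dist a c q k :
  (forall j, 0 <= a j <= 1) -> (forall j, 0 <= c j <= 1) ->
  `|power_increment a q.+1 k - power_increment c q.+1 k| <=
  2 * q.+1%:R * k.+1%:R ^+ q * \sum_(j < k.+1) `|a j - c j|.
Proof.
move=> a01 c01.
have step m : (m <= k.+1)%N ->
    `|(\sum_(j < m) a j) ^+ q.+1 - (\sum_(j < m) c j) ^+ q.+1| <=
    q.+1%:R * k.+1%:R ^+ q * \sum_(j < k.+1) `|a j - c j|.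
  move=> mk; have /andP[s0 sm] := partial_sum_bound m a01.
  have /andP[s0' sm'] := partial_sum_bound m c01.
  have mk' : m%:R <= k.+1%:R :> R by rewrite ler_nat.
  apply: (le_trans (expr_lipschitz (K := k.+1%:R) q _ _)).
  - by rewrite s0 (le_trans sm).
  - by rewrite s0' (le_trans sm').
  rewrite ler_wpM2l ?mulr_ge0 ?exprn_ge0 // -sumrB (le_trans (ler_norm_sum _ _ _)) //.
  rewrite -!(big_mkord xpredT (fun j => `|a j - c j|)).
  by rewrite (big_cat_nat _ mk) //= lerDl sumr_ge0.
have := lerD (step k.+1 (leqnn _)) (step k (leqnSn _)).
set z := (X in _ <= X + X -> _) => le2z.
rewrite -[leRHS](_ : z + z = _); last by rewrite /z; ring.
apply: le_trans le2z; rewrite /power_increment.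
rewrite (_ : _ - _ - _ = (\sum_(j < k.+1) a j) ^+ q.+1 - (\sum_(j < k.+1) c j) ^+ q.+1 -
  ((\sum_(j < k) a j) ^+ q.+1 - (\sum_(j < k) c j) ^+ q.+1)); last by ring.
exact: ler_normB.
Qed.

Lemma cvge_expe (f : nat -> \bar R) (l : \bar R) q : (0 <= l)%E ->
  f n @[n --> \oo] --> l -> ((f n) ^+ q @[n --> \oo] --> l ^+ q)%E.
Proof.
move=> l0 fl; elim: q => [|q ih]; first exact: cvg_cst.
under eq_fun do rewrite expeS; rewrite expeS; apply: cvgeM => //.
move: l l0 {ih fl} => [r|_|//]; last first.
  by apply: mule_def_infty_neq0 => //; rewrite gt_eqF // expe_gt0.
by move=> _; apply: mule_def_fin => //; rewrite -EFin_expe.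
Qed.

Lemma series_expe a q : (forall j, 0 <= a j <= 1) ->
  ((\sum_(k <oo) (a k)%:E) ^+ q.+1 =
   \sum_(k <oo) (power_increment a q.+1 k)%:E)%E.
Proof.
move=> a01; have a0 k : (0 <= (a k)%:E)%E by rewrite lee_fin; have /andP[] := a01 k.
apply/esym/cvg_lim => //.
rewrite (_ : (fun n => _) = (fun n => (\sum_(0 <= k < n) (a k)%:E) ^+ q.+1)%E).
  apply: cvge_expe; first exact: nneseries_ge0.
  by apply: is_cvg_nneseries => k _ _; exact: a0.
apply/funext => n; rewrite !sumEFin -EFin_expe; congr EFin.
rewrite (telescope_sumr (fun k => (\sum_(j < k) a j) ^+ q.+1)) //.
by rewrite big_ord0 expr0n subr0 big_mkord.
Qed.

End PowerIncrements.

(** * Dominated convergence of series *)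

Section Tannery.
Context (R : realType).

Lemma bernoulli_inequality (x : R) n : -1 <= x -> 1 + n%:R * x <= (1 + x) ^+ n.
Proof.
move=> x1; elim: n => [|n ih]; first by rewrite mul0r addr0.
rewrite exprS (@le_trans _ _ ((1 + x) * (1 + n%:R * x))) //; last first.
  by rewrite ler_wpM2l // -lerBlDl sub0r.
rewrite -natr1; have : 0 <= n%:R * x ^+ 2 by rewrite mulr_ge0 ?sqr_ge0.
by lra.
Qed.

(** With [e := (1 - rho) / m.+1], both [rho <= (1 - e) ^+ m.+1] and
    [k.+1%:R * (1 - e) ^+ k <= e^-1] follow from the Bernoulli inequality. *)
Lemma polynomial_geometric (rho : R) m : 0 <= rho < 1 ->
  exists K r : R, [/\ 0 <= K, 0 <= r < 1 &
    forall k, k.+1%:R ^+ m * rho ^+ k <= K * r ^+ k].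
Proof.
move=> /andP[rho0 rho1].
pose e := (1 - rho) / m.+1%:R.
have e0 : 0 < e by rewrite divr_gt0 // subr_gt0.
have e1 : e <= 1.
  rewrite ler_pdivrMr // mul1r (@le_trans _ _ 1) ?ler1n //; lra.
have rhoe : rho <= (1 - e) ^+ m.+1.
  apply: le_trans (bernoulli_inequality _ _); last by lra.
  by rewrite mulrN mulrC divfK ?pnatr_eq0 //; lra.
have ke k : k.+1%:R * (1 - e) ^+ k <= e^-1.
  rewrite -[e^-1]mul1r ler_pdivlMr //.
  have r0 : 0 <= (1 - e) ^+ k by rewrite exprn_ge0 // subr_ge0.
  have re : (1 - e) ^+ k * (1 + e) ^+ k <= 1.
    by rewrite -exprMn exprn_ile1 //; nra.
  apply: le_trans re; rewrite mulrAC mulrC ler_wpM2l //.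
  apply: le_trans (bernoulli_inequality _ _); last by lra.
  by rewrite -natr1; lra.
exists (e^-1 ^+ m), (1 - e); split=> [||k]; first by apply: exprn_ge0; rewrite invr_ge0 ltW.
  by rewrite subr_ge0 e1 /= gtrBl.
have r0 : 0 <= 1 - e by rewrite subr_ge0.
apply: (@le_trans _ _ (k.+1%:R ^+ m * (1 - e) ^+ (m.+1 * k))).
  by rewrite ler_wpM2l ?exprn_ge0 // exprM lerXn2r // nnegrE exprn_ge0.
rewrite mulSn exprD mulrCA mulrC (mulnC m) exprM -exprMn ler_wpM2r ?exprn_ge0 //.
by rewrite lerXn2r // ?nnegrE ?mulr_ge0 ?exprn_ge0 ?invr_ge0 ?(ltW e0).
Qed.

Lemma geometric_eseries_fin (K r : R) : 0 <= r < 1 ->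
  (\sum_(k <oo) (K * r ^+ k)%:E < +oo)%E.
Proof.
move=> /andP[r0 r1].
rewrite (_ : (\sum_(k <oo) _)%E = (K / (1 - r))%:E) ?ltry //.
apply/cvg_lim => //; rewrite (_ : (fun n => _) = EFin \o series (geometric K r)).
  by apply/cvg_EFin; [apply: nearW|apply: cvg_geometric_series; rewrite ger0_norm].
by apply/funext => n; rewrite sumEFin /=.
Qed.

(** Dominated convergence for the counting measure. *)
Lemma tannery (u : nat -> nat -> \bar R) (B : nat -> \bar R) :
  (forall n k, 0 <= u n k <= B k)%E -> (\sum_(k <oo) B k < +oo)%E ->
  (forall k, B k \is a fin_num) ->
  (forall k, u n k @[n --> \oo] --> 0%E) ->
  (\sum_(k <oo) u n k)%E @[n --> \oo] --> 0%E.
Proof.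
move=> uB sB finB u0.
have uge0 n k : (0 <= u n k)%E by have /andP[] := uB n k.
have Bge0 k : (0 <= B k)%E by have /andP[+] := uB 0%N k; exact: le_trans.
under eq_fun do rewrite -ge0_integral_count //.
rewrite -(integral0 (counting : {measure set nat -> \bar R}) setT).
apply: (@dominated_cvg _ _ _ _ _ _ _ _ B) => //.
- by move=> k _; exact: u0.
- apply/integrableP; split=> //.
  by under eq_integral do rewrite gee0_abs //; rewrite ge0_integral_count.
- by move=> n k _; rewrite gee0_abs //; have /andP[] := uB n k.
Qed.

End Tannery.
(** * Comparison of two sequences of random series *)

Section SeriesComparison.
Local Open Scope ereal_scope.
Context (d : measure_display) (T : measurableType d) (R : realType).
Variables (P : probability T R) (a c : nat -> nat -> T -> R) (C rho : R).
Hypothesis ma : forall n k, measurable_fun setT (a n k).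
Hypothesis mc : forall n k, measurable_fun setT (c n k).
Hypothesis a01 : forall n k t, (0 <= a n k t <= 1)%R.
Hypothesis c01 : forall n k t, (0 <= c n k t <= 1)%R.
Hypothesis rho01 : (0 <= rho < 1)%R.
Hypothesis ea : forall n k, \int[P]_t (a n k t)%:E <= (C * rho ^+ k)%:E.
Hypothesis ec : forall n k, \int[P]_t (c n k t)%:E <= (C * rho ^+ k)%:E.
Hypothesis eac : forall k, \int[P]_t (`|a n k t - c n k t|%R)%:E @[n --> \oo] --> 0.

Let X n t := \sum_(k <oo) (a n k t)%:E.
Let W n t := \sum_(k <oo) (c n k t)%:E.

Definition increment_distance q n k t : R :=
  `|power_increment (a n ^~ t) q.+1 k - power_increment (c n ^~ t) q.+1 k|%R.

Definition series_distance q n t : \bar R :=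
  \sum_(k <oo) (increment_distance q n k t)%:E.

Let C0 : (0 <= C)%R.
Proof.
have := ea 0 0; rewrite expr0 mulr1 -lee_fin; apply: le_trans.
by apply: integral_ge0 => t _; rewrite lee_fin; have /andP[] := a01 0 0 t.
Qed.

Lemma measurable_nonneg_series (e : nat -> T -> R) :
  (forall k t, (0 <= e k t)%R) -> (forall k, measurable_fun setT (e k)) ->
  measurable_fun setT (fun t => \sum_(k <oo) (e k t)%:E).
Proof.
move=> e0 me.
apply: (@ge0_emeasurable_sum _ _ _ _ (fun k t => (e k t)%:E) xpredT) => [k t _ _|k _].
  by rewrite lee_fin.
exact/measurable_EFinP.
Qed.

Lemma measurable_power_increment (e : nat -> T -> R) q k :
  (forall k, measurable_fun setT (e k)) ->
  measurable_fun setT (fun t => power_increment (e ^~ t) q k).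
Proof.
move=> me; apply: measurable_funB; apply: measurable_funX;
  exact: measurable_sum.
Qed.

Lemma measurable_increment_distance q n k :
  measurable_fun setT (increment_distance q n k).
Proof.
apply: measurableT_comp => //.
by apply: measurable_funB; exact: measurable_power_increment.
Qed.

Lemma measurable_series_distance q n : measurable_fun setT (series_distance q n).
Proof.
apply: measurable_nonneg_series => k; first by move=> t; exact: normr_ge0.
exact: measurable_increment_distance.
Qed.

Lemma series_distance_ge0 q n t : 0 <= series_distance q n t.
Proof. by apply: nneseries_ge0 => k _ _; rewrite lee_fin normr_ge0. Qed.

Lemma integral_increment_distance_le q n k :
  \int[P]_t (increment_distance q n k t)%:E <=
  (2 * q.+1%:R * C * (k.+1%:R ^+ q * rho ^+ k))%:E.
Proof.
set K : R := (q.+1%:R * k.+1%:R ^+ q)%R.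
have K0 : (0 <= K)%R by rewrite mulr_ge0 ?exprn_ge0.
have a0 t : 0 <= (a n k t)%:E by rewrite lee_fin; have /andP[] := a01 n k t.
have c0 t : 0 <= (c n k t)%:E by rewrite lee_fin; have /andP[] := c01 n k t.
have ma' : measurable_fun setT (fun t => (a n k t)%:E) by exact/measurable_EFinP.
have mc' : measurable_fun setT (fun t => (c n k t)%:E) by exact/measurable_EFinP.
apply: (@le_trans _ _ (\int[P]_t (K%:E * ((a n k t)%:E + (c n k t)%:E)))).
  apply: ge0_le_integral => //=.
  - by move=> t _; rewrite lee_fin normr_ge0.
  - exact/measurable_EFinP/measurable_increment_distance.
  - apply: measurable_funeM; exact: emeasurable_funD.
  - move=> t _; rewrite -EFinD -EFinM lee_fin /increment_distance mulrDr.
    have /andP[i0 iK] := power_increment_bound q k (fun j => a01 n j t).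
    have /andP[i0' iK'] := power_increment_bound q k (fun j => c01 n j t).
    rewrite (le_trans (ler_normB _ _)) // !ger0_norm //; exact: lerD.
rewrite ge0_integralZl_EFin //=; last 2 first.
- by move=> t _; exact: adde_ge0.
- exact: emeasurable_funD.
rewrite ge0_integralD //.
rewrite (_ : (2 * q.+1%:R * C * (k.+1%:R ^+ q * rho ^+ k))%:E =
    K%:E * ((C * rho ^+ k)%:E + (C * rho ^+ k)%:E)); last first.
  by rewrite -EFinD -EFinM; congr EFin; rewrite /K; ring.
by apply: lee_wpmul2l; [rewrite lee_fin|exact: leeD].
Qed.

Lemma cvg_integral_increment_distance q k :
  \int[P]_t (increment_distance q n k t)%:E @[n --> \oo] --> 0.
Proof.
set K : R := (2 * q.+1%:R * k.+1%:R ^+ q)%R.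
have K0 : (0 <= K)%R by rewrite !mulr_ge0 ?exprn_ge0.
have me n j : measurable_fun setT (fun t => (`|a n j t - c n j t|%R)%:E).
  by apply/measurable_EFinP/measurableT_comp => //; exact: measurable_funB.
apply: (@squeeze_cvge _ _ _ _ (fun=> 0) _
  (fun n => K%:E * \sum_(j < k.+1) \int[P]_t (`|a n j t - c n j t|%R)%:E)).
- apply: nearW => n; apply/andP; split.
    by apply: integral_ge0 => t _; rewrite lee_fin normr_ge0.
  rewrite -ge0_integral_sum //.
  rewrite -ge0_integralZl_EFin //; last 2 first.
  + by move=> t _; apply: sume_ge0 => j _; rewrite lee_fin.
  + exact: emeasurable_sum.
  apply: ge0_le_integral => //.
  + by move=> t _; rewrite lee_fin normr_ge0.
  + exact/measurable_EFinP/measurable_increment_distance.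
  + by apply: measurable_funeM; exact: emeasurable_sum.
  + move=> t _; rewrite sumEFin -EFinM lee_fin.
    by apply: power_increment_dist => j; [exact: a01|exact: c01].
- exact: cvg_cst.
- rewrite [X in _ --> X](_ : 0 = K%:E * \sum_(j < k.+1) 0); last first.
    by rewrite big1 ?mule0.
  apply: cvgeZl => //.
  apply: (cvg_nnesum (P := xpredT) (l := fun=> 0)
    (f := fun (j : 'I_k.+1) n => \int[P]_t (`|a n j t - c n j t|%R)%:E)) => [j _|j _].
    by apply: nearW => n; apply: integral_ge0 => t _; rewrite lee_fin.
  exact: eac.
Qed.

Let integral_series_distance q n : \int[P]_t series_distance q n t =
  \sum_(k <oo) \int[P]_t (increment_distance q n k t)%:E.
Proof.
rewrite integral_nneseries // => [k|k t _]; last by rewrite lee_fin normr_ge0.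
exact/measurable_EFinP/measurable_increment_distance.
Qed.

(** The polynomial growth of the increments is absorbed by the geometric decay
    of the expected terms, uniformly in [n]. *)
Let geometric_domination q : exists K r : R, (0 <= r < 1)%R /\
  forall n k, 0 <= \int[P]_t (increment_distance q n k t)%:E <= (K * r ^+ k)%:E.
Proof.
have [K [r [K0 r01 Kr]]] := polynomial_geometric q rho01.
exists (2 * q.+1%:R * C * K)%R, r; split=> // n k; apply/andP; split.
  by apply: integral_ge0 => t _; rewrite lee_fin normr_ge0.
apply: (le_trans (integral_increment_distance_le q n k)).
by rewrite lee_fin -(mulrA _ K) ler_wpM2l // !mulr_ge0.
Qed.

Lemma cvg_integral_series_distance q :
  \int[P]_t series_distance q n t @[n --> \oo] --> 0.
Proof.
have [K [r [r01 Kr]]] := geometric_domination q.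
rewrite (funext (integral_series_distance q)).
apply: (@tannery _ _ (fun k => (K * r ^+ k)%:E)) => //.
  exact: geometric_eseries_fin.
by move=> k; exact: cvg_integral_increment_distance.
Qed.

Lemma integral_series_distance_fin q n :
  \int[P]_t series_distance q n t \is a fin_num.
Proof.
have [K [r [r01 Kr]]] := geometric_domination q.
rewrite ge0_fin_numE; last by apply: integral_ge0 => t _; exact: series_distance_ge0.
rewrite integral_series_distance; apply: le_lt_trans (geometric_eseries_fin K r01).
by apply: lee_nneseries => [k _ _|k _]; have /andP[] := Kr n k.
Qed.

(** Two inequalities replace a bound on a difference, which has no meaning where
    the series are infinite. *)
Lemma power_le_series_distance q n t :
  X n t ^+ q.+1 <= W n t ^+ q.+1 + series_distance q n t /\
  W n t ^+ q.+1 <= X n t ^+ q.+1 + series_distance q n t.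
Proof.
rewrite /X /W (series_expe q (fun j => a01 n j t)) (series_expe q (fun j => c01 n j t)).
have inc0 (e : nat -> R) k : (forall j, 0 <= e j <= 1)%R ->
  0 <= (power_increment e q.+1 k)%:E.
  by move=> /power_increment_bound-/(_ q k)/andP[]; rewrite lee_fin.
have i0 k : 0 <= (power_increment (a n ^~ t) q.+1 k)%:E by exact: inc0.
have i0' k : 0 <= (power_increment (c n ^~ t) q.+1 k)%:E by exact: inc0.
have d0 k : 0 <= (increment_distance q n k t)%:E.
  by rewrite lee_fin normr_ge0.
split; rewrite -nneseriesD //.
  apply: lee_nneseries => [k _ _|k _]; first exact: i0.
  by rewrite -EFinD lee_fin -lerBlDl ler_norm.
apply: lee_nneseries => [k _ _|k _]; first exact: i0'.
by rewrite -EFinD lee_fin -lerBlDl /increment_distance distrC ler_norm.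
Qed.

End SeriesComparison.
Section SeriesTransfer.
Local Open Scope ereal_scope.
Context (d : measure_display) (T : measurableType d) (R : realType).
Variable P : probability T R.

Lemma measurable_expe (q : nat) :
  measurable_fun setT (fun y : \bar R => y ^+ q).
Proof.
elim: q => [|q ih]; first exact: measurable_cst.
by under eq_fun do rewrite expeS; exact: emeasurable_funM.
Qed.

Variables (a c : nat -> nat -> T -> R) (C rho : R) (M : T -> \bar R).
Hypothesis ma : forall n k, measurable_fun setT (a n k).
Hypothesis mc : forall n k, measurable_fun setT (c n k).
Hypothesis a01 : forall n k t, (0 <= a n k t <= 1)%R.
Hypothesis c01 : forall n k t, (0 <= c n k t <= 1)%R.
Hypothesis rho01 : (0 <= rho < 1)%R.
Hypothesis ea : forall n k, \int[P]_t (a n k t)%:E <= (C * rho ^+ k)%:E.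
Hypothesis ec : forall n k, \int[P]_t (c n k t)%:E <= (C * rho ^+ k)%:E.
Hypothesis eac : forall k, \int[P]_t (`|a n k t - c n k t|%R)%:E @[n --> \oo] --> 0.
Hypothesis cM : forall n,
  eq_in_distribution P P (fun t => \sum_(k <oo) (c n k t)%:E) M.
Hypothesis M0 : forall t, 0 <= M t.

Let X n t := \sum_(k <oo) (a n k t)%:E.
Let W n t := \sum_(k <oo) (c n k t)%:E.
Let D := series_distance a c.

Let X0 n t : 0 <= X n t.
Proof. by apply: nneseries_ge0 => k _ _; rewrite lee_fin; have /andP[] := a01 n k t. Qed.

Let W0 n t : 0 <= W n t.
Proof. by apply: nneseries_ge0 => k _ _; rewrite lee_fin; have /andP[] := c01 n k t. Qed.

Let D0 q n t : 0 <= D q n t. Proof. exact: series_distance_ge0. Qed.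

Let mX n : measurable_fun setT (X n).
Proof.
by apply: measurable_nonneg_series => // k t; have /andP[] := a01 n k t.
Qed.

Let mW n : measurable_fun setT (W n).
Proof.
by apply: measurable_nonneg_series => // k t; have /andP[] := c01 n k t.
Qed.

Let mM : measurable_fun setT M. Proof. by have [] := cM 0%N. Qed.

Let mD q n : measurable_fun setT (D q n).
Proof. exact: measurable_series_distance. Qed.

Let moment_eq q n : \int[P]_t (W n t ^+ q) = \int[P]_t (M t ^+ q).
Proof.
have mf : measurable_fun setT (fun y : \bar R => `|y| ^+ q).
  by apply: (measurableT_comp (measurable_expe q)); exact: abse_measurable.
have := eq_distribution_integral (cM n) mf (fun y => expe_ge0 q (abse_ge0 y)).
under eq_integral do rewrite (gee0_abs (W0 _ _)).
by under [X in _ = X -> _]eq_integral do rewrite (gee0_abs (M0 _)).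
Qed.

(* The series [W] is compared with the null series. *)
Let moment_fin q : \int[P]_t (M t ^+ q.+1) \is a fin_num.
Proof.
rewrite -(moment_eq _ 0).
pose z (_ _ : nat) (_ : T) : R := 0%R.
have z01 n k t : (0 <= z n k t <= 1)%R by rewrite lexx ler01.
have ez n k : \int[P]_t (z n k t)%:E <= (C * rho ^+ k)%:E.
  rewrite integral0; apply: le_trans (ec n k).
  by apply: integral_ge0 => t _; rewrite lee_fin; have /andP[] := c01 n k t.
have mz n k : measurable_fun setT (z n k) by exact: measurable_cst.
have := integral_series_distance_fin mz mc z01 c01 rho01 ez ec q 0.
have mDz : measurable_fun setT (series_distance z c q 0).
  exact: measurable_series_distance.
rewrite !ge0_fin_numE; last 2 first.
- by apply: integral_ge0 => t _; exact: expe_ge0.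
- by apply: integral_ge0 => t _; exact: series_distance_ge0.
apply: le_lt_trans; apply: ge0_le_integral => //.
- by move=> t _; exact: expe_ge0.
- exact: (measurableT_comp (measurable_expe q.+1) (mW 0)).
- move=> t _; have [_] := power_le_series_distance z01 c01 q 0 t.
  rewrite (_ : \sum_(k <oo) (z 0 k t)%:E = 0); last exact: eseries0.
  by rewrite (_ : 0 ^+ q.+1 = 0) ?add0e //; apply/eqP; rewrite expe_eq0 eqxx.
Qed.

Lemma series_cvg_moments : cvg_moments P X M.
Proof.
move=> [|q].
  split; last by under eq_fun do under eq_integral do rewrite expe0; exact: cvg_cst.
  by apply/integrableP; split; [exact: measurable_cst|
    under eq_integral do rewrite expe0 abse1; rewrite integral_cst // mul1e (le_lt_trans (probability_le1 _ _)) ?ltry].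
split.
  apply/integrableP; split.
    exact: (measurableT_comp (measurable_expe q.+1) mM).
  under eq_integral do rewrite gee0_abs ?expe_ge0 //.
  by rewrite -ge0_fin_numE //; apply: integral_ge0 => t _; exact: expe_ge0.
have mWq n : measurable_fun setT (fun t => W n t ^+ q.+1).
  exact: (measurableT_comp (measurable_expe q.+1) (mW n)).
have mXq n : measurable_fun setT (fun t => X n t ^+ q.+1).
  exact: (measurableT_comp (measurable_expe q.+1) (mX n)).
have Xle n : \int[P]_t (X n t ^+ q.+1) <=
    \int[P]_t (M t ^+ q.+1) + \int[P]_t D q n t.
  rewrite -(moment_eq _ n) -ge0_integralD //; last by move=> t _; exact: expe_ge0.
  apply: ge0_le_integral => //.
  - by move=> t _; exact: expe_ge0.
  - exact: emeasurable_funD.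
  - by move=> t _; have [] := power_le_series_distance a01 c01 q n t.
have leX n : \int[P]_t (M t ^+ q.+1) - \int[P]_t D q n t <=
    \int[P]_t (X n t ^+ q.+1).
  rewrite leeBlDr; last exact: (integral_series_distance_fin ma mc a01 c01 rho01 ea ec q n).
  rewrite -(moment_eq _ n) -ge0_integralD //; last by move=> t _; exact: expe_ge0.
  apply: ge0_le_integral => //.
  - by move=> t _; exact: expe_ge0.
  - exact: emeasurable_funD.
  - by move=> t _; have [] := power_le_series_distance a01 c01 q n t.
have D0cvg : \int[P]_t D q n t @[n --> \oo] --> 0.
  exact: (cvg_integral_series_distance ma mc a01 c01 rho01 ea ec eac q).
apply: (squeeze_cvge (f := fun n => \int[P]_t (M t ^+ q.+1) - \int[P]_t D q n t)
  (h := fun n => \int[P]_t (M t ^+ q.+1) + \int[P]_t D q n t)).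
- by apply: nearW => n; rewrite leX Xle.
- rewrite -[X in _ --> X]sube0; apply: cvgeB => //; last exact: cvg_cst.
  exact: fin_num_adde_defl.
- rewrite -[X in _ --> X]adde0; apply: cvgeD => //; last exact: cvg_cst.
  exact: fin_num_adde_defl.
Qed.

Let cdf (Y : T -> \bar R) (x : R) := P [set t | Y t <= x%:E].

Let mcdf (Y : T -> \bar R) (x : R) : measurable_fun setT Y ->
  measurable [set t | Y t <= x%:E].
Proof. by move=> mY; rewrite -[X in measurable X]setTI; exact: emeasurable_fun_infty_c. Qed.

(* Outside the event [e <= D], whose probability the Markov inequality bounds,
   [Y] exceeds [Z] by at most [e]. *)
Let cdf_compare (Y Z : T -> \bar R) n (x e : R) :
  measurable_fun setT Y -> measurable_fun setT Z ->
  (forall t, Y t <= Z t + D 0 n t) -> (0 < e)%R ->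
  cdf Z x <= cdf Y (x + e) + e^-1%:E * \int[P]_t D 0 n t.
Proof.
move=> mY mZ YZ e0.
have mDe : measurable [set t | e%:E <= D 0 n t].
  by rewrite -[X in measurable X]setTI; exact: emeasurable_fun_c_infty.
have PD : P [set t | e%:E <= D 0 n t] <= e^-1%:E * \int[P]_t D 0 n t.
  rewrite lee_pdivlMl // muleC.
  have := le_integral_comp_abse P measurableT (@measurable_id _ _ setT)
    (fun r r0 => r0) (fun x y _ _ xy => xy) (mD 0 n) e0.
  rewrite setTI /= muleC; under eq_integral do rewrite (gee0_abs (D0 _ _ _)).
  by under eq_set do rewrite (gee0_abs (D0 _ _ _)).
apply: (@le_trans _ _ (P ([set t | Y t <= (x + e)%:E] `|` [set t | e%:E <= D 0 n t]))).
  apply: le_measure; rewrite ?inE; [exact: mcdf| |].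
    by apply: measurableU => //; exact: mcdf.
  move=> t /= Zx; have [eD|De] := leP e%:E (D 0 n t); [by right|left].
  by rewrite (le_trans (YZ t)) // EFinD leeD // ltW.
apply: (@le_trans _ _ (cdf Y (x + e) + P [set t | e%:E <= D 0 n t])).
  by apply: measureU2 => //; exact: mcdf.
exact: leeD.
Qed.

Let cdfW n x : cdf (W n) x = cdf M x.
Proof.
have [_ _ /(_ [set y | y <= x%:E])] := cM n; apply.
have := emeasurable_fun_infty_c measurableT (@measurable_id _ (\bar R) setT) x%:E.
by rewrite setTI.
Qed.

Let cdf_fin Y x : measurable_fun setT Y -> cdf Y x \is a fin_num.
Proof. by move=> mY; apply: fin_num_measure; exact: mcdf. Qed.

(** At a continuity point of the limit, the shift by [s] moves its distribution
    function by at most half of the tolerance; the other half absorbs the Markov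
    bound for large [n]. *)
Lemma series_cvg_in_distribution : cvg_in_distribution P X M.
Proof.
split=> // x; rewrite -/(cdf M) => contM.
have power1 n t := power_le_series_distance a01 c01 0 n t.
have XM n y e : (0 < e)%R ->
    cdf (X n) y <= cdf M (y + e) + e^-1%:E * \int[P]_t D 0 n t.
  rewrite -(cdfW n) => e0; apply: cdf_compare => // t.
  by have [_] := power1 n t.
have MX n y e : (0 < e)%R ->
    cdf M y <= cdf (X n) (y + e) + e^-1%:E * \int[P]_t D 0 n t.
  rewrite -(cdfW n) => e0; apply: cdf_compare => // t.
  by have [] := power1 n t.
have D0cvg : \int[P]_t D 0 n t @[n --> \oo] --> 0.
  exact: (cvg_integral_series_distance ma mc a01 c01 rho01 ea ec eac 0).
have finD n : \int[P]_t D 0 n t \is a fin_num.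
  exact: (integral_series_distance_fin ma mc a01 c01 rho01 ea ec 0 n).
have finM y : cdf M y \is a fin_num by exact: cdf_fin.
have finX n : cdf (X n) x \is a fin_num by exact: cdf_fin.
rewrite -[X in _ --> X](fineK (finM x)); apply/fine_cvgP; split.
  by apply: nearW => n; exact: finX.
apply/cvgrPdist_le => e e0.
have e20 : (0 < e / 2)%R by rewrite divr_gt0.
have : (fine \o cdf M) y @[y --> x] --> fine (cdf M x).
  by apply: fine_cvg; rewrite fineK //; exact: contM.
move=> /cvgrPdist_le/(_ _ e20)/nbhs_ballP[r /= r0 xr].
pose s : R := (r / 2)%R.
have s0 : (0 < s)%R by rewrite divr_gt0.
have near_cdf y : (`|x - y| <= s)%R -> (`|fine (cdf M x) - fine (cdf M y)| <= e / 2)%R.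
  by move=> xy; apply: xr; rewrite /ball /= (le_lt_trans xy) // /s; lra.
have /fine_cvgP[_ /cvgrPdist_le/(_ (s * (e / 2))%R)] := D0cvg.
move=> /(_ (mulr_gt0 s0 e20)); apply: filterS => n /=.
set dn := fine _; rewrite sub0r normrN => dnle.
have dn_small : (s^-1 * dn <= e / 2)%R.
  by rewrite ler_pdivrMl // (le_trans (ler_norm _)).
have := XM n x s s0; have := MX n (x - s)%R s s0.
rewrite subrK -(fineK (finX n)) -(fineK (finM (x + s)%R)) -(fineK (finM (x - s)%R)).
rewrite -(fineK (finD n)) -/dn -!EFinM -!EFinD !lee_fin => lo hi.
have := near_cdf (x + s)%R; have := near_cdf (x - s)%R.
rewrite opprB addrCA subrr addr0 opprD addNKr normrN gtr0_norm // lexx.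
move=> /(_ isT) + /(_ isT); rewrite !ler_norml => /andP[? ?] /andP[? ?].
by apply/andP; split; lra.
Qed.

End SeriesTransfer.
(** * A weak law of large numbers *)

Section LawOfLargeNumbers.
Local Open Scope ereal_scope.
Context (d : measure_display) (T : measurableType d) (R : realType).
Variables (P : probability T R) (A : nat -> set T) (q : R).
Hypothesis mA : forall i, measurable (A i).
Hypothesis PA : forall i, P (A i) = q%:E.
Hypothesis PAA : forall i j, i != j -> P (A i `&` A j) = (q * q)%:E.

Definition frequency (n : nat) (t : T) : R :=
  ((\sum_(i < n) \1_(A i) t) / n%:R)%R.

Let mN n : measurable_fun setT (fun t => (\sum_(i < n) \1_(A i) t)%R : R).
Proof. by apply: measurable_sum => i; exact: measurable_indic. Qed.

Let mfreq n : measurable_fun setT (frequency n).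
Proof. exact: measurable_funM. Qed.

Let q0 : (0 <= q)%R.
Proof. by rewrite -lee_fin -(PA 0) measure_ge0. Qed.

Let sum_indic_ge0 n t : (0 <= (\sum_(i < n) \1_(A i) t : R))%R.
Proof. by apply: sumr_ge0. Qed.

Let expectation_constant (r : R) : \int[P]_t r%:E = r%:E.
Proof.
rewrite integral_cst // -[RHS]mule1; congr (_ * _); exact: probability_setT.
Qed.

Let expected_count n :
  \int[P]_t ((\sum_(i < n) \1_(A i) t)%R%:E) = (n%:R * q)%:E.
Proof.
under eq_integral do rewrite -sumEFin.
rewrite -sum_indic //; under eq_bigr do rewrite PA.
rewrite sumEFin sumr_const card_ord.
by rewrite mulr_natl.
Qed.

Let expected_count_sqr n :
  \int[P]_t ((\sum_(i < n) \1_(A i) t) ^+ 2)%R%:E <= (n%:R + n%:R ^+ 2 * q ^+ 2)%:E.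
Proof.
have sqrE t : ((\sum_(i < n) \1_(A i) t) ^+ 2)%R%:E =
    \sum_(i < n) \sum_(j < n) (\1_(A i `&` A j) t)%:E :> \bar R.
  rewrite expr2 mulr_suml -sumEFin; apply: eq_bigr => i _.
  rewrite mulr_sumr -sumEFin; apply: eq_bigr => j _.
  by rewrite indicI.
under eq_integral do rewrite sqrE.
have mAA i j : measurable (A i `&` A j) by exact: measurableI.
rewrite ge0_integral_sum //=; last 2 first.
- by move=> i; apply: emeasurable_sum => j; exact/measurable_EFinP/measurable_indic.
- by move=> i t _; apply: sume_ge0 => j _; rewrite lee_fin.
rewrite (eq_bigr (fun i : 'I_n => \sum_(j < n) P (A i `&` A j))) => [|i _]; last first.
  by rewrite (@sum_indic _ _ _ P n (fun j => A i `&` A j)).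
rewrite (_ : (n%:R + n%:R ^+ 2 * q ^+ 2)%R = \sum_(i < n) (1 + n%:R * (q * q))%R)%R; last first.
  by rewrite sumr_const card_ord -mulr_natl; ring.
rewrite -sumEFin; apply: lee_sum => i _; rewrite (bigD1 i) //= EFinD leeD //.
  exact: probability_le1.
rewrite (eq_bigr (fun=> (q * q)%:E)) => [|j ji]; last by rewrite PAA // eq_sym.
rewrite sumEFin lee_fin sumr_const -[leLHS]mulr_natl ler_wpM2r ?mulr_ge0 // ler_nat.
by rewrite -[leqRHS]card_ord max_card.
Qed.

(** Pairwise independence leaves only the diagonal terms of the variance. *)
Lemma integral_frequency_variance n : (0 < n)%N ->
  \int[P]_t ((frequency n t - q) ^+ 2)%R%:E <= (n%:R^-1)%:E.
Proof.
move=> n0; have n0' : (n%:R != 0 :> R)%R by rewrite pnatr_eq0 -lt0n.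
have my : measurable_fun setT (fun t => ((frequency n t - q) ^+ 2)%R%:E).
  by apply/measurable_EFinP/measurable_funX/measurable_funB.
have mN2 : measurable_fun setT (fun t => ((\sum_(i < n) \1_(A i) t) ^+ 2)%R%:E : \bar R).
  by apply/measurable_EFinP/measurable_funX.
have mN1 : measurable_fun setT (fun t => (\sum_(i < n) \1_(A i) t)%R%:E : \bar R).
  by apply/measurable_EFinP.
(* The cross term of the square stays on the left, so that every integrand is
   nonnegative. *)
have eqn : \int[P]_t (((frequency n t - q) ^+ 2)%R%:E +
      (2 * q / n%:R)%:E * (\sum_(i < n) \1_(A i) t)%R%:E) =
    \int[P]_t ((n%:R ^- 2)%:E * ((\sum_(i < n) \1_(A i) t) ^+ 2)%R%:E + (q ^+ 2)%:E).
  apply: eq_integral => t _; rewrite -!EFinM -!EFinD /frequency; congr EFin.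
  by field.
have K0 : (0 <= 2 * q / n%:R)%R by rewrite !mulr_ge0 // invr_ge0.
have L0 : (0 <= n%:R ^- 2 :> R)%R by rewrite invr_ge0 exprn_ge0.
have sqr0 (x : R) : 0 <= (x ^+ 2)%:E by rewrite lee_fin sqr_ge0.
have sum0 t : 0 <= (\sum_(i < n) \1_(A i) t)%R%:E :> \bar R.
  by rewrite lee_fin sum_indic_ge0.
move: eqn; rewrite ge0_integralD //; first last.
- exact: measurable_funeM.
- by move=> t _; apply: mule_ge0.
rewrite ge0_integralZl_EFin // expected_count ge0_integralD //; first last.
- exact: measurable_funeM.
- by move=> t _; apply: mule_ge0.
rewrite ge0_integralZl_EFin //.
rewrite expectation_constant => eqn.
have : \int[P]_t ((frequency n t - q) ^+ 2)%R%:E + (2 * q ^+ 2)%:E <=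
    (n%:R ^- 2)%:E * (n%:R + n%:R ^+ 2 * q ^+ 2)%:E + (q ^+ 2)%:E.
  rewrite (_ : (2 * q ^+ 2)%:E = (2 * q / n%:R)%:E * (n%:R * q)%:E); last first.
    by rewrite -EFinM; congr EFin; field.
  by rewrite eqn leeD2r // lee_wpmul2l ?lee_fin.
rewrite -EFinM -EFinD -leeBrDr // -EFinB => /le_trans; apply.
rewrite lee_fin le_eqVlt; apply/orP; left; apply/eqP; by field.
Qed.

(** The mean deviation follows from the variance through
    [`|y| <= e + e^-1 * y ^+ 2]. *)
Lemma cvg_frequency :
  \int[P]_t (`|frequency n t - q|%R)%:E @[n --> \oo] --> 0.
Proof.
have bound (e : R) n : (0 < e)%R -> (0 < n)%N ->
    \int[P]_t (`|frequency n t - q|%R)%:E <= (e + e^-1 / n%:R)%:E.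
  move=> e0 n0; have e0' : (0 <= e^-1)%R by rewrite invr_ge0 ltW.
  have my : measurable_fun setT (fun t => ((frequency n t - q) ^+ 2)%R%:E).
    by apply/measurable_EFinP/measurable_funX/measurable_funB.
  have myn : measurable_fun setT (fun t => (`|frequency n t - q|%R)%:E).
    by apply/measurable_EFinP/measurableT_comp => //; exact: measurable_funB.
  apply: (@le_trans _ _ (\int[P]_t (e%:E + e^-1%:E * ((frequency n t - q) ^+ 2)%R%:E))).
    apply: ge0_le_integral => //.
    - by apply: emeasurable_funD => //; exact: measurable_funeM.
    - move=> t _; rewrite -EFinM -EFinD lee_fin.
      set y := (frequency n t - q)%R.
      rewrite -[(y ^+ 2)%R]real_normK ?num_real //.
      rewrite -(ler_pM2l e0) mulrDr mulrA mulfV ?gt_eqF // mul1r.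
      have := sqr_ge0 (e - `|y|)%R; have := sqr_ge0 e; have := sqr_ge0 (`|y|)%R.
      have : (0 <= e * `|y|)%R by rewrite mulr_ge0 // ltW.
      by nra.
  have sqr0 (x : R) : 0 <= (x ^+ 2)%:E by rewrite lee_fin sqr_ge0.
  have e0E : 0 <= e^-1%:E by rewrite lee_fin.
  rewrite ge0_integralD //; first last.
  - exact: measurable_funeM.
  - by move=> t _; apply: mule_ge0.
  - by move=> t _; rewrite lee_fin ltW.
  rewrite expectation_constant EFinD leeD2l //.
  rewrite ge0_integralZl_EFin //.
  by rewrite EFinM lee_wpmul2l ?lee_fin // integral_frequency_variance.
have fin n : (0 < n)%N -> \int[P]_t (`|frequency n t - q|%R)%:E \is a fin_num.
  move=> n0; rewrite ge0_fin_numE; last by apply: integral_ge0 => t _; rewrite lee_fin.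
  by rewrite (le_lt_trans (bound 1%R n _ n0)) ?ltry.
apply/fine_cvgP; split; first by exists 1%N.
apply/cvgrPdist_le => e e0; have e20 : (0 < e / 2)%R by rewrite divr_gt0.
near=> n; rewrite /= sub0r normrN.
have n0 : (0 < n)%N by near: n; exists 1%N.
have n0' : (0 < n%:R :> R)%R by rewrite ltr0n.
rewrite ger0_norm; last first.
  by apply: fine_ge0; apply: integral_ge0 => t _; rewrite lee_fin.
rewrite -lee_fin fineK ?fin // (le_trans (bound _ _ e20 n0)) // lee_fin.
rewrite [leRHS](splitr e) lerD2l ler_pdivrMr // -ler_pdivrMl //.
by near: n; exact: nbhs_infty_ger.
Unshelve. all: by end_near. Qed.

End LawOfLargeNumbers.
(** * The cost of Radix Selection *)

Lemma LambdaE (b : nat) (s : nat -> string b) (n k : nat) (v : string b) :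
  Lambda s n k v = #|[set i : 'I_n | agree k v (s i)]%SET|.
Proof.
by apply: eq_card => i; rewrite inE -lcp_geE; apply/asboolP/idP.
Qed.

Section Selection.
Local Open Scope ereal_scope.
Context (d : measure_display) (T : measurableType d) (b : nat).
Variable S : nat -> T -> string b.
Hypothesis mS : forall i, random_string (S i).

Lemma measurable_bucket n k (V : T -> string b) (Q : set {set 'I_n}) :
  random_string V ->
  measurable [set t | Q [set i : 'I_n | agree k (V t) (S i t)]%SET].
Proof.
move=> mV; apply: (measurable_finite_test (B := fun (i : 'I_n) t => agree k (V t) (S i t))) => i.
exact: measurable_agree.
Qed.

Variables (I : nat -> T -> nat).
Hypothesis mI : forall n, measurable_fun setT (I n).

Definition selected n t : string b := order_stat (S ^~ t) n (I n t).

Lemma random_string_selected n : random_string (selected n).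
Proof.
move=> A mA; rewrite [X in measurable X](_ : _ =
    [set t | (fun i => S i @^-1` A) (rank_index (S ^~ t) n (I n t)) t]).
  by apply: (@measurable_random_rank_event _ _ _ _ mS n (I n) (fun i => S i @^-1` A)) => // i; exact: mS.
by apply/seteqP; split=> t /=; rewrite /selected order_statE.
Qed.

End Selection.

Section RadixCost.
Local Open Scope ereal_scope.
Context (R : realType) (b : nat) (hb : (1 < b)%N) (mu : 'I_b -> R) (p : 'M[R]_b).
Hypothesis hsource : positive_source mu p.
Context (d : measure_display) (T : measurableType d) (P : probability T R).
Variable S : nat -> T -> string b.
Hypothesis mS : forall i, random_string (S i).
Hypothesis hmarkov : forall i, markov_chain P mu p (S i).
Hypothesis hindep : mutually_independent P (fun i => string_sigma_of (S i)).
Variable I : nat -> T -> nat.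
Hypothesis mI : forall n, measurable_fun setT (I n).
Hypothesis hI : forall n l : nat, (1 <= l <= n)%N ->
  P (I n @^-1` [set l]) = (n%:R^-1)%:E.
Hypothesis hIindep : forall n : nat, (1 <= n)%N ->
  independent2 P (preimage_set_system setT (I n) measurable) (string_seq_sigma S).

Let V := selected S I.

Let mV n : random_string (V n). Proof. exact: random_string_selected. Qed.

(** The term of index [k] of the normalised cost. *)
Definition bucket_share n k t : R :=
  ((Lambda (S ^~ t) n k (V n t) * (1 < Lambda (S ^~ t) n k (V n t)))%N%:R / n%:R)%R.

(** The term of index [k] of the limit, taken at the selected string. *)
Definition prefix_share n k t : R := word_weight mu p (mkseq (V n t) k).

Lemma same_law i A : string_sigma A -> P (S i @^-1` A) = P (S 0%N @^-1` A).
Proof.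
apply: (law_unique hb) => // x.
by rewrite !(prob_cylinder hb _ (hmarkov _)).
Qed.

Lemma selected_law n A : string_sigma A -> P (V n @^-1` A) = P (S 0%N @^-1` A).
Proof.
move=> mA; case: n => [|n].
  by rewrite (_ : V 0 = S 0) //; apply/funext => t; rewrite /V /selected /order_stat nth_nil.
have sA i : string_seq_sigma S (S i @^-1` A).
  apply: sub_sigma_algebra; exists i => //; exists A => //.
  by rewrite setTI.
have := resampling mS (ltn0Sn n) (mI _) (@hI n.+1) (@hIindep n.+1 isT) sA.
rewrite (_ : [set t | _] = V n.+1 @^-1` A) => [->|]; last first.
  by apply/seteqP; split=> t /=; rewrite /V /selected order_statE.
under eq_bigr do rewrite same_law //.
have : P (S 0%N @^-1` A) \is a fin_num by apply: fin_num_measure; exact: mS.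
case: (P (S 0%N @^-1` A)) => // r _.
by rewrite sumEFin -EFinM sumr_const card_ord -(mulr_natl r) mulrA mulVf ?mul1r //.
Qed.

Lemma prefix_weight_law (d1 d2 : measure_display) (T1 : measurableType d1)
    (T2 : measurableType d2) (P1 : probability T1 R) (P2 : probability T2 R)
    (X1 : T1 -> string b) (X2 : T2 -> string b) :
  random_string X1 -> random_string X2 ->
  (forall A, string_sigma A -> P1 (X1 @^-1` A) = P2 (X2 @^-1` A)) ->
  eq_in_distribution P1 P2 (fun t => prefix_weight mu p (X1 t))
    (fun t => prefix_weight mu p (X2 t)).
Proof.
move=> mX1 mX2 X12; split; [exact: measurable_prefix_weight..|] => B mB.
have mpB : string_sigma ((fun w => prefix_weight mu p w) @^-1` B).
  have := measurable_prefix_weight hsource (@random_string_id b hb).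
  by move=> /(_ measurableT B mB); rewrite setTI.
exact: X12 mpB.
Qed.

Lemma Lambda_le s n k (v : string b) : (Lambda s n k v <= n)%N.
Proof. by rewrite -[leqRHS]card_ord max_card. Qed.

Lemma bucket_share_unit n k t : (0 <= bucket_share n k t <= 1)%R.
Proof.
rewrite /bucket_share divr_ge0 //=; case: n => [|n]; first by rewrite invr0 mulr0.
rewrite ler_pdivrMr // mul1r ler_nat (leq_trans _ (Lambda_le (S ^~ t) n.+1 k (V n.+1 t))) //.
by rewrite -[leqRHS]muln1 leq_mul2l leq_b1 orbT.
Qed.

Lemma measurable_bucket_share n k : measurable_fun setT (bucket_share n k).
Proof.
move=> _ B mB; rewrite setTI.
rewrite (_ : _ @^-1` B = [set t |
    [set A : {set 'I_n} | B ((#|A| * (1 < #|A|))%N%:R / n%:R : R)%R]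
    [set i : 'I_n | agree k (V n t) (S i t)]%SET]).
  exact: measurable_bucket.
by apply/seteqP; split=> t /=; rewrite /bucket_share LambdaE.
Qed.

Lemma measurable_prefix_share n k : measurable_fun setT (prefix_share n k).
Proof.
move=> _ B mB; rewrite setTI.
exact: (measurable_prefix k (fun x => B (word_weight mu p x)) (mV n)).
Qed.

Lemma normalized_costE n t :
  Ycost R (S ^~ t) n (I n t) * (n%:R^-1)%:E = \sum_(k <oo) (bucket_share n k t)%:E.
Proof.
rewrite /Ycost /Zcost muleC -nneseriesZl => [|k _]; last by rewrite lee_fin.
by apply: eq_eseriesr => k _; rewrite -EFinM mulrC.
Qed.

Lemma prefix_share_unit n k t : (0 <= prefix_share n k t <= 1)%R.
Proof.
have [rho /andP[rho0 rho1] rhoP] := word_weight_geometric hsource.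
rewrite /prefix_share word_weight_ge0 //= (le_trans (rhoP _)) //.
by rewrite exprn_ile1 // ltW.
Qed.

Section Decay.
Variable rho : R.
Hypothesis rho0 : (0 <= rho)%R.
Hypothesis rhoP : forall x, (word_weight mu p x <= rho ^+ size x)%R.

Lemma integral_prefix_share n k :
  \int[P]_t (prefix_share n k t)%:E <= (2 * rho ^+ k)%:E.
Proof.
apply: (@le_trans _ _ (\int[P]_t (rho ^+ k)%:E)).
  apply: ge0_le_integral => //.
  - by move=> t _; rewrite lee_fin; have /andP[] := prefix_share_unit n k t.
  - exact/measurable_EFinP/measurable_prefix_share.
  - move=> t _; rewrite lee_fin /prefix_share (le_trans (rhoP _)) //.
    by rewrite size_mkseq.
rewrite integral_cst // -[leRHS]mule1 EFinM -muleA; apply: le_trans (_ : (rho ^+ k)%:E <= _).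
  rewrite -[leRHS]mule1 lee_wpmul2l ?lee_fin ?exprn_ge0 //.
  exact: probability_le1.
by rewrite mule1 -EFinM lee_fin ler_peMl ?exprn_ge0 // ler1n.
Qed.

(* The condition on [Lambda] keeps the diagonal case [i = j] rare: the bucket
   then holds a second string. *)
Let pair_event N k (j i : nat) : set T :=
  [set t | agree k (S i t) (S j t) && (1 < Lambda (S ^~ t) N k (S i t))%N].

Let measurable_pair_event (d0 : measure_display) (T0 : measurableType d0)
    (S0 : nat -> T0 -> string b) N k (X : T0 -> string b) j :
  (forall i, random_string (S0 i)) -> random_string X ->
  measurable [set t | agree k (X t) (S0 j t) && (1 < Lambda (S0 ^~ t) N k (X t))%N].
Proof.
move=> mS0 mX; rewrite [X in measurable X](_ : _ =
    [set t | agree k (X t) (S0 j t)] `&`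
    [set t | [set A : {set 'I_N} | (1 < #|A|)%N]
       [set i : 'I_N | agree k (X t) (S0 i t)]%SET]).
  by apply: measurableI; [exact: measurable_agree|exact: measurable_bucket].
by apply/seteqP; split=> t /=; rewrite LambdaE => /andP.
Qed.

Let prob_pair_event N k j i : i != j -> P (pair_event N k j i) <= (rho ^+ k)%:E.
Proof.
move=> ij; apply: le_trans (prob_agree_independent hsource hb k mS hmarkov hindep ij rhoP).
apply: le_measure; rewrite ?inE; [exact: measurable_pair_event|exact: measurable_agree|].
by move=> t /andP[].
Qed.

Let prob_diagonal_event N k (j : 'I_N) :
  P (pair_event N k j j) <= (N%:R * rho ^+ k)%:E.
Proof.
pose A (l : nat) := if l == j then set0 else [set t | agree k (S j t) (S l t)].
have mA l : measurable (A l).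
  by rewrite /A; case: eqP => // _; exact: measurable_agree.
have PA l : P (A l) <= (rho ^+ k)%:E.
  rewrite /A; case: eqP => [_|/eqP lj].
    by rewrite measure0 lee_fin exprn_ge0.
  by apply: (prob_agree_independent hsource hb) => //; rewrite eq_sym.
apply: (@le_trans _ _ (P (\big[setU/set0]_(l < N) A l))).
  apply: le_measure; rewrite ?inE; [exact: measurable_pair_event| |].
    exact: bigsetU_measurable.
  move=> t /andP[_]; rewrite LambdaE => /card_gt1P[x [y [+ + xy]]].
  rewrite !inE => Sx Sy; rewrite -bigcup_mkord.
  have [xj|xj] := eqVneq x j; last by exists x => //=; rewrite /A (negbTE (xj : (x : nat) != j)).
  exists y => //=; rewrite /A; case: eqP => // /val_inj yj.
  by move: xy; rewrite xj yj eqxx.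
apply: (le_trans (Boole_inequality P (fun l _ => mA l))).
apply: (@le_trans _ _ (\sum_(l < N) (rho ^+ k)%:E)); first by apply: lee_sum => l _; exact: PA.
by rewrite sumEFin sumr_const card_ord mulr_natl.
Qed.

Let sum_pair_event N k (j : 'I_N) :
  \sum_(i < N) P (pair_event N k j i) <= (2 * N%:R * rho ^+ k)%:E.
Proof.
rewrite (bigD1 j) //= -mulrA mulr_natl mulr2n EFinD leeD //.
apply: (@le_trans _ _ (\sum_(i < N | i != j) (rho ^+ k)%:E)).
  by apply: lee_sum => i ij; exact: prob_pair_event.
rewrite sumEFin lee_fin sumr_const -[leLHS]mulr_natl ler_wpM2r ?exprn_ge0 // ler_nat.
by rewrite -[leqRHS]card_ord max_card.
Qed.

(** Writing a bucket size as a sum over its members [j] and resampling the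
    selected string into [i] gives an average over the pairs [(i, j)]; on the
    diagonal, the bucket counts only if it holds a further string. *)
Lemma integral_bucket_share n k :
  \int[P]_t (bucket_share n k t)%:E <= (2 * rho ^+ k)%:E.
Proof.
case: n => [|n].
  rewrite (_ : (fun t => _) = cst 0).
    by rewrite integral0 lee_fin mulr_ge0 ?exprn_ge0.
  by apply/funext => t; rewrite /bucket_share invr0 mulr0.
set N := n.+1; have N0 : (N%:R != 0 :> R)%R by rewrite pnatr_eq0.
pose F (j : nat) := [set t | agree k (V N t) (S j t) &&
  (1 < Lambda (S ^~ t) N k (V N t))%N].
have mF j : measurable (F j) by exact: measurable_pair_event.
have shareE t : (bucket_share N k t)%:E =
    (N%:R^-1)%:E * \sum_(j < N) (\1_(F j) t)%:E.
  rewrite sumEFin -EFinM; congr EFin; rewrite /bucket_share mulrC; congr (_ * _)%R.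
  rewrite {1}LambdaE -sum1_card big_distrl natr_sum /= big_mkcond /=.
  apply: eq_bigr => j _; rewrite indicE inE mul1n.
  have -> : (t \in F j) = agree k (V N t) (S j t) &&
      (1 < Lambda (S ^~ t) N k (V N t))%N.
    by apply/idP/idP => [/set_mem|Ft] //; exact: mem_set.
  by case: (agree _ _ _).
under eq_integral do rewrite shareE.
rewrite ge0_integralZl_EFin //; last 2 first.
- by move=> t _; apply: sume_ge0 => j _; rewrite lee_fin.
- by apply: emeasurable_sum => j; exact/measurable_EFinP/measurable_indic.
rewrite -sum_indic //.
have PF (j : 'I_N) : P (F j) <= (2 * rho ^+ k)%:E.
  have sE i : string_seq_sigma S (pair_event N k j i).
    have mSg := @random_string_generated _ T b S.
    have := @measurable_pair_event _
      (g_sigma_algebraType (\bigcup_i string_sigma_of (S i))) S N k (S i) j mSg (mSg i).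
    exact.
  have := resampling mS (ltn0Sn n) (mI _) (@hI n.+1) (@hIindep n.+1 isT) sE.
  rewrite (_ : [set t | _] = F j) => [->|]; last first.
    by apply/seteqP; split=> t; rewrite /F /pair_event /= /V /selected order_statE.
  apply: (@le_trans _ _ ((N%:R^-1)%:E * (2 * N%:R * rho ^+ k)%:E)).
    apply: lee_wpmul2l; first by rewrite lee_fin invr_ge0.
    exact: sum_pair_event.
  by rewrite -EFinM lee_fin le_eqVlt; apply/orP; left; apply/eqP; field.
apply: (@le_trans _ _ ((N%:R^-1)%:E * \sum_(j < N) (2 * rho ^+ k)%:E)).
  apply: lee_wpmul2l; first by rewrite lee_fin invr_ge0.
  by apply: lee_sum => j _; exact: PF.
rewrite sumEFin sumr_const card_ord -EFinM lee_fin -[X in (_ * X <= _)%R]mulr_natl.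
by rewrite mulrA mulVf // mul1r.
Qed.

End Decay.

(** Summing the deviations over all words [x] of length [k] gives a bound that
    no longer depends on the selected string; the term [n^-1] accounts for the
    buckets with a single string, which are not counted. *)
Lemma bucket_share_dist n k t : (0 < n)%N ->
  (`|bucket_share n k t - prefix_share n k t| <= n%:R^-1 +
    \sum_(x : k.-tuple 'I_b)
      `|frequency R (fun j => S j @^-1` cylinder x) n t - word_weight mu p x|)%R.
Proof.
move=> n0; have n0' : (0 < n%:R :> R)%R by rewrite ltr0n.
set L := Lambda (S ^~ t) n k (V n t).
pose x0 := [tuple of mkseq (V n t) k].
have freqE : frequency R (fun j => S j @^-1` cylinder x0) n t = (L%:R / n%:R)%R.
  rewrite /frequency /L LambdaE -sum1_card natr_sum [in RHS]big_mkcond /=.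
  congr (_ / _)%R; apply: eq_bigr => j _; rewrite indicE inE.
  have -> : (t \in S j @^-1` cylinder x0) = agree k (V n t) (S j t).
    apply/idP/idP => [/set_mem|Vj].
      by rewrite /cylinder /= size_mkseq agree_sym /agree => ->.
    by apply: mem_set; rewrite /cylinder /= size_mkseq (eqP Vj).
  by case: agree.
rewrite (bigD1 x0) //= freqE.
apply: (@le_trans _ _ (n%:R^-1 + `|L%:R / n%:R - word_weight mu p x0|)%R); last first.
  by rewrite lerD2l lerDl sumr_ge0.
rewrite (le_trans (ler_distD (L%:R / n%:R)%R _ _)) // lerD2r /bucket_share -/L.
have n1 : (0 <= n%:R^-1 :> R)%R by rewrite invr_ge0 ltW.
rewrite -mulrBl normrM [X in (_ * X)%R]ger0_norm // ler_piMl //.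
case: (ltngtP 1 L) => [_|L1|<-]; rewrite ?muln1 ?muln0 ?subrr ?normr0 // sub0r normrN.
  by rewrite ger0_norm // lern1 -ltnS ltnW.
by rewrite normr1.
Qed.

Lemma cvg_bucket_share k :
  \int[P]_t (`|bucket_share n k t - prefix_share n k t|%R)%:E @[n --> \oo] --> 0.
Proof.
pose freq (x : k.-tuple 'I_b) n t : R :=
  `|frequency R (fun j => S j @^-1` cylinder x) n t - word_weight mu p x|%R.
have mcyl i (x : seq 'I_b) : measurable (S i @^-1` cylinder x).
  exact: measurable_cylinder.
have mfreq (x : k.-tuple 'I_b) n : measurable_fun setT (fun t => (freq x n t)%:E).
  apply/measurable_EFinP/measurableT_comp => //; apply: measurable_funB => //.
  by apply: measurable_funM => //; apply: measurable_sum => j; exact: measurable_indic.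
have freq_cvg (x : k.-tuple 'I_b) : \int[P]_t (freq x n t)%:E @[n --> \oo] --> 0.
  apply: (@cvg_frequency _ _ _ P (fun j => S j @^-1` cylinder x)) => // [i|i j ij].
    exact: prob_cylinder.
  rewrite (independent_pair hindep ij); try exact: string_sigma_of_cylinder.
  by rewrite !(prob_cylinder hb x (hmarkov _)).
apply: (@squeeze_cvge _ _ _ _ (fun=> 0) _ (fun n =>
    (n%:R^-1)%:E + \sum_(x : k.-tuple 'I_b) \int[P]_t (freq x n t)%:E)).
- exists 1%N => // n /= n0; apply/andP; split.
    by apply: integral_ge0 => t _; rewrite lee_fin normr_ge0.
  rewrite -ge0_integral_sum // => [|x t _]; last by rewrite lee_fin normr_ge0.
  rewrite -[(n%:R^-1)%:E](_ : \int[P]_t (n%:R^-1)%:E = _); last first.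
    rewrite integral_cst // -[RHS]mule1; congr (_ * _); exact: probability_setT.
  have msum : measurable_fun setT (fun t => \sum_(x : k.-tuple 'I_b) (freq x n t)%:E).
    exact: emeasurable_sum.
  rewrite -ge0_integralD // => [|t _]; last first.
    by apply: sume_ge0 => x _; rewrite lee_fin normr_ge0.
  apply: ge0_le_integral => //.
  + apply/measurable_EFinP/measurableT_comp => //; apply: measurable_funB.
      exact: measurable_bucket_share.
    exact: measurable_prefix_share.
  + exact: emeasurable_funD.
  + by move=> t _; rewrite sumEFin -EFinD lee_fin; exact: bucket_share_dist.
- exact: cvg_cst.
- rewrite [X in _ --> X](_ : 0 = 0 + \sum_(x : k.-tuple 'I_b) 0); last first.
    by rewrite big1 ?adde0.
  apply: cvgeD => //.
    rewrite -cvg_shiftS; exact: cvge_harmonic.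
  apply: (cvg_nnesum (P := xpredT) (l := fun=> 0)
    (f := fun (x : k.-tuple 'I_b) n => \int[P]_t (freq x n t)%:E)) => [x _|x _].
    by apply: nearW => n; apply: integral_ge0 => t _; rewrite lee_fin normr_ge0.
  exact: freq_cvg.
Qed.

End RadixCost.
(** * The quantile string *)

Lemma random_string_cylinder (d : measure_display) (T : measurableType d)
    (b : nat) (X : T -> string b) :
  (forall x, measurable (X @^-1` cylinder x)) -> random_string X.
Proof.
move=> mX; apply: smallest_sub => [|A [x _ <-]]; last exact: mX.
split=> [|A mA|A mA] /=.
- by rewrite preimage_set0.
- by rewrite setTD preimage_setC; exact: measurableC.
- by rewrite preimage_bigcup; exact: bigcup_measurable.
Qed.

Lemma strle_anti (b : nat) (v w : string b) : strle v w -> strle w v -> v = w.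
Proof.
move=> /strleP[//|[i [/agreeP ai li]]] /strleP[//|[j [/agreeP aj lj]]].
exfalso; case: (ltngtP i j) => ij.
- by move: li; rewrite aj // ltnn.
- by move: lj; rewrite ai // ltnn.
- by move: lj; rewrite -ij ltnNge (ltnW li).
Qed.

Section ExtremeStrings.
Variables (b : nat) (hb : (1 < b)%N) (x : seq 'I_b).

Let greatest_letter_subproof : (b.-1 < b)%N.
Proof. by rewrite ltn_predL ltnW. Qed.

Definition least_string : string b := nth (Ordinal (ltnW hb)) x.
Definition greatest_string : string b := nth (Ordinal greatest_letter_subproof) x.

Lemma cylinder_least : cylinder x least_string.
Proof. by rewrite /cylinder /= mkseq_nth. Qed.

Lemma cylinder_greatest : cylinder x greatest_string.
Proof. by rewrite /cylinder /= mkseq_nth. Qed.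

Lemma cylinder_nth v c j : cylinder x v -> (j < size x)%N -> v j = nth c x j.
Proof. by move=> {2}<- jx; rewrite nth_mkseq. Qed.

Lemma least_string_le v : cylinder x v -> strle least_string v.
Proof.
move=> xv; have [//|[j [_ lj]]] := strle_or_gt least_string v.
move: lj; rewrite /least_string; have [jx|xj] := ltnP j (size x).
  by rewrite -(cylinder_nth _ xv jx) ltnn.
by rewrite nth_default.
Qed.

Lemma greatest_string_ge v : cylinder x v -> strle v greatest_string.
Proof.
move=> xv; have [//|[j [_ lj]]] := strle_or_gt v greatest_string.
move: lj; rewrite /greatest_string; have [jx|xj] := ltnP j (size x).
  by rewrite -(cylinder_nth _ xv jx) ltnn.
rewrite nth_default //=; have := ltn_ord (v j); lia.
Qed.

End ExtremeStrings.

Lemma uniform_prob_itv (R : realType) (u v : R) : 0 <= u -> u <= v -> v <= 1 ->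
  uniform_prob (@ltr01 R) `[u, v[ = (v - u)%:E.
Proof.
move=> u0 uv v1; rewrite /uniform_prob.
rewrite (eq_integral (fun=> 1%:E)) => [|t]; last first.
  rewrite inE /= in_itv /= => /andP[ut tv]; rewrite /uniform_pdf.
  by rewrite (le_trans u0 ut) (le_trans (ltW tv) v1) /= subr0 invr1.
rewrite integral_cst //= mul1e lebesgue_measure_itv /= lte_fin.
by case: ltgtP uv => // -> _; rewrite subrr.
Qed.

Section Quantile.
Local Open Scope ereal_scope.
Context (R : realType) (b : nat) (hb : (1 < b)%N) (mu : 'I_b -> R) (p : 'M[R]_b).
Hypothesis hsource : positive_source mu p.
Context (d : measure_display) (T : measurableType d) (P : probability T R).
Variable X : T -> string b.
Hypothesis mX : random_string X.
Hypothesis markovX : markov_chain P mu p X.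

Let F := string_cdf P X.
Let quantile := quantile_string P hb X.

Let measurable_cdf_event w : measurable [set t | strle (X t) w].
Proof. exact: measurable_strle mX (@random_string_cst _ T b w). Qed.

Lemma string_cdf_homo v w : strle v w -> F v <= F w.
Proof.
move=> vw; apply: le_measure; rewrite ?inE //.
by move=> t /= Xv; exact: strle_trans vw.
Qed.

Lemma string_cdf_fin w : F w \is a fin_num.
Proof. exact: fin_num_measure. Qed.

(** Prefixes of length [k] have probability at most [rho ^+ k]. *)
Lemma prob_string_eq0 w : P [set t | X t = w] = 0.
Proof.
have [rho /andP[rho0 rho1] rhoP] := word_weight_geometric hsource.
have mXw : measurable [set t | X t = w].
  exact: measurable_string_eq mX (@random_string_cst _ T b w).
have le_rho k : P [set t | X t = w] <= (rho ^+ k)%:E.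
  apply: (@le_trans _ _ (P [set t | agree k (X t) w])).
    apply: le_measure; rewrite ?inE //; first exact: measurable_agree mX (@random_string_cst _ T b w).
    by move=> t /= ->; exact/agreeP.
  by rewrite (prob_agree_string _ _ markovX) lee_fin -[k in (rho ^+ k)%R](size_mkseq w).
apply/eqP; rewrite eq_le measure_ge0 andbT.
have : P [set t | X t = w] \is a fin_num by exact: fin_num_measure.
case: (P _) le_rho => // r le_rho _; rewrite lee_fin leNgt; apply/negP => r0.
have /cvgrPdist_lt/(_ r r0)[N _ /(_ N (leqnn N))/=] : (rho ^+ k)%R @[k --> \oo] --> (0 : R)%R.
  by apply: cvg_expr; rewrite ger0_norm.
rewrite sub0r normrN ger0_norm ?exprn_ge0 //.
by rewrite ltNge -lee_fin le_rho.
Qed.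

(** The least string of the cylinder, counted on the left in both terms, has
    probability zero. *)
Lemma string_cdf_cylinder x :
  F (least_string hb x) + (word_weight mu p x)%:E <= F (greatest_string hb x).
Proof.
set lo := least_string hb x; set hi := greatest_string hb x.
have mlo : measurable [set t | X t = lo].
  exact: measurable_string_eq mX (@random_string_cst _ T b lo).
have mcyl : measurable (X @^-1` cylinder x) by exact: measurable_cylinder.
have mD : measurable (X @^-1` cylinder x `\` [set t | X t = lo]) by exact: measurableD.
rewrite -(prob_cylinder hb x markovX).
apply: (@le_trans _ _ (F lo + P (X @^-1` cylinder x `\` [set t | X t = lo]))).
  rewrite leeD2l // -[leRHS]adde0 -(prob_string_eq0 lo).
  apply: (@le_trans _ _ (P ((X @^-1` cylinder x `\` [set t | X t = lo]) `|` [set t | X t = lo]))).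
    apply: le_measure; rewrite ?inE //; first exact: measurableU.
    by move=> t xt; have [|] := pselect (X t = lo); [right|left].
  exact: measureU2.
rewrite /F /string_cdf -measureU //; last first.
  apply/seteqP; split=> // t [/= Xlo [xX ne]]; apply: ne.
  by apply: strle_anti => //; exact: least_string_le.
apply: le_measure; rewrite ?inE //; first exact: measurableU.
move=> t /= [Xlo|[xX _]]; last exact: greatest_string_ge.
by apply: (strle_trans Xlo); apply: least_string_le; exact: cylinder_greatest.
Qed.

Lemma quantile_homo (r s : R) : (r <= s)%R -> strle (quantile r) (quantile s).
Proof.
move=> rs; have [_] := strsupP hb [set v | F v <= r%:E].
apply=> v /= vr; have [+ _] := strsupP hb [set v | F v <= s%:E].
by apply; rewrite /= (le_trans vr).
Qed.

(** The least string of the cylinder enters the supremum, and the greatest one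
    bounds it. *)
Lemma quantile_cylinder x (r : R) :
  F (least_string hb x) <= r%:E < F (greatest_string hb x) ->
  cylinder x (quantile r).
Proof.
move=> /andP[lor rhi]; have [ub least] := strsupP hb [set v | F v <= r%:E].
apply: (cylinder_convex (u := least_string hb x) (w := greatest_string hb x)).
- exact: ub.
- apply: least => v /= vr; have [//|[j [hiv lj]]] := strle_or_gt v (greatest_string hb x).
  have /string_cdf_homo Fhi : strle (greatest_string hb x) v.
    by apply/strleP; right; exists j; rewrite agree_sym.
  by move: (le_lt_trans (le_trans Fhi vr) rhi); rewrite ltxx.
- exact: cylinder_least.
- exact: cylinder_greatest.
Qed.

Context (d' : measure_display) (T' : measurableType d') (P' : probability T' R).
Variable xi : {RV P' >-> R}.
Hypothesis hxi : forall A : set R, measurable A ->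
  distribution P' xi A = uniform_prob (@ltr01 R) A.

Let measurable_quantile x : measurable [set r | cylinder x (quantile r)].
Proof.
apply: is_interval_measurable => r s /= xr xs y /andP[ry ys].
exact: (cylinder_convex (quantile_homo ry) (quantile_homo ys)).
Qed.

Lemma random_string_quantile : random_string (fun t => quantile (xi t)).
Proof.
apply: random_string_cylinder => x.
have := @measurable_funP _ _ _ _ setT xi measurableT _ (measurable_quantile x).
by rewrite setTI.
Qed.

Let quantile_cylinder_ge x :
  (word_weight mu p x)%:E <= P' ((fun t => quantile (xi t)) @^-1` cylinder x).
Proof.
rewrite -[leRHS]/(distribution P' xi [set r | cylinder x (quantile r)]) hxi //.
set lo := least_string hb x; set hi := greatest_string hb x.
have := string_cdf_cylinder x; rewrite -/lo -/hi.
have : F hi <= 1 by exact: probability_le1.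
have : 0 <= F lo by exact: measure_ge0.
have := quantile_cylinder (x := x); rewrite -/lo -/hi.
move: (string_cdf_fin lo) (string_cdf_fin hi).
case: (F lo) => // u _; case: (F hi) => // v _ qx.
rewrite -EFinD !lee_fin => u0 v1 uv.
have w0 := word_weight_ge0 hsource x.
apply: (@le_trans _ _ (uniform_prob (@ltr01 R) `[u, v[)).
  by rewrite uniform_prob_itv // ?lee_fin; lra.
apply: le_measure; rewrite ?inE //; exact: measurable_quantile.
Qed.

(** Both sides are probability distributions on the words of a given length, so
    the inequality between them is an equality. *)
Lemma quantile_law A : string_sigma A ->
  P (X @^-1` A) = P' ((fun t => quantile (xi t)) @^-1` A).
Proof.
apply: (law_unique hb) => //; first exact: random_string_quantile.
move=> x; rewrite (prob_cylinder hb x markovX).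
pose Q (y : seq 'I_b) := P' ((fun t => quantile (xi t)) @^-1` cylinder y).
have mQ y : measurable ((fun t => quantile (xi t)) @^-1` cylinder y).
  exact: measurable_cylinder random_string_quantile.
have finQ y : Q y \is a fin_num by exact: fin_num_measure.
have sumQ : (\sum_(y : (size x).-tuple 'I_b) fine (Q y) = 1)%R.
  apply: EFin_inj; rewrite -sumEFin; under eq_bigr do rewrite fineK //.
  rewrite -(probability_setT P') (measure_prefix_partition P' (size x) random_string_quantile measurableT).
  by apply: eq_bigr => y _; rewrite setTI.
have sumW : (\sum_(y : (size x).-tuple 'I_b) word_weight mu p y = 1)%R.
  by apply: EFin_inj; rewrite -sumEFin; exact: (sum_word_weight hb (size x) mX markovX).
rewrite -[RHS]/(Q x) -(fineK (finQ x)); congr EFin; apply/esym.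
have : (\sum_(y : (size x).-tuple 'I_b) (fine (Q y) - word_weight mu p y) = 0)%R.
  by rewrite sumrB sumQ sumW subrr.
move=> /psumr_eq0P-/(_ _ (in_tuple x) isT) /= W0.
apply/eqP; rewrite -subr_eq0 W0 // => y _.
by rewrite subr_ge0 -lee_fin fineK //; exact: quantile_cylinder_ge.
Qed.

End Quantile.
Unset Implicit Arguments.

Theorem corollary1p4 (R : realType) (b : nat) (hb : (1 < b)%N)
    (mu : 'I_b -> R) (p : 'M[R]_b) (hsource : positive_source mu p)
    (d : measure_display) (T : measurableType d) (P : probability T R)
    (S : nat -> T -> string b)
    (hS : forall i, random_string (S i))
    (hmarkov : forall i, markov_chain P mu p (S i))
    (hindep : mutually_independent P (fun i => string_sigma_of (S i)))
    (I : nat -> {RV P >-> nat})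
    (hI : forall n l : nat, (1 <= l <= n)%N ->
       P (I n @^-1` [set l]) = (n%:R^-1)%:E)
    (hIindep : forall n : nat, (1 <= n)%N ->
       independent2 P (preimage_set_system setT (I n) measurable)
         (string_seq_sigma S))
    (d' : measure_display) (T' : measurableType d') (P' : probability T' R)
    (xi : {RV P' >-> R})
    (hxi : forall A : set R, measurable A ->
       distribution P' xi A = uniform_prob (@ltr01 R) A) :
  let X := fun (n : nat) (t : T) =>
    (Ycost R (fun i => S i t) n (I n t) * (n%:R^-1)%:E)%E in
  let M := fun t : T => prefix_weight mu p (S 0%N t) in
  [/\ cvg_in_distribution P X M,
      cvg_moments P X M &
      eq_in_distribution P P' M
        (fun t => prefix_weight mu p (quantile_string P hb (S 0%N) (xi t)))].
Proof.
have mI n : measurable_fun setT (I n) by exact: measurable_funP.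
have [rho /andP[rho0 rho1] rhoP] := word_weight_geometric hsource.
have rho01 : 0 <= rho < 1 by rewrite rho0 rho1.
pose a := bucket_share R S (fun n => I n).
pose c := prefix_share mu p S (fun n => I n).
have ma n k : measurable_fun setT (a n k) by exact: measurable_bucket_share.
have mc n k : measurable_fun setT (c n k) by exact: measurable_prefix_share.
have a01 n k t : 0 <= a n k t <= 1 by exact: bucket_share_unit.
have c01 n k t : 0 <= c n k t <= 1 by exact: prefix_share_unit.
have ea n k : (\int[P]_t (a n k t)%:E <= (2 * rho ^+ k)%:E)%E.
  exact: (integral_bucket_share hb hsource hS hmarkov hindep mI hI hIindep).
have ec n k : (\int[P]_t (c n k t)%:E <= (2 * rho ^+ k)%:E)%E.
  exact: integral_prefix_share.
have eac k : (\int[P]_t (`|a n k t - c n k t|%R)%:E @[n --> \oo] --> 0)%E.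
  exact: (cvg_bucket_share hb hS hmarkov hindep mI).
move=> X M.
have XE : X = fun n t => (\sum_(k <oo) (a n k t)%:E)%E.
  by apply/funext => n; apply/funext => t; exact: normalized_costE.
have cM n : eq_in_distribution P P (fun t => (\sum_(k <oo) (c n k t)%:E)%E) M.
  have -> : (fun t => (\sum_(k <oo) (c n k t)%:E)%E) =
      fun t => prefix_weight mu p (selected S (fun n => I n) n t).
    by apply/funext => t; rewrite prefix_weightE.
  apply: (prefix_weight_law hb) => //; first exact: random_string_selected.
  exact: selected_law.
have M0 t : (0 <= M t)%E.
  by apply: esum_ge0 => x _; rewrite lee_fin word_weight_ge0.
rewrite XE; split.
- exact: (series_cvg_in_distribution ma mc a01 c01 rho01 ea ec eac cM).
- exact: (series_cvg_moments ma mc a01 c01 rho01 ea ec eac cM M0).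
- apply: (prefix_weight_law hb) => //; first exact: random_string_quantile.
  exact: (quantile_law hb hsource (hS 0%N) (hmarkov 0%N) hxi).
Qed.
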